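(* There exists a constant $c>0$ such that the following holds for every large enough integer $n$. In the $(1:1)$ Maker-Breaker game played on the edge set of the complete graph $K_n$, Maker has a strategy to occupy a graph which contains a copy of every tree $T$ with $n$ vertices and maximum degree $\Delta(T)\leq \frac{cn}{\log(n)}$.
   Context: In the $(1:1)$ Maker-Breaker game on $K_n$, Maker and Breaker alternately claim one previously unclaimed edge of $K_n$ each (Maker first) until all edges are claimed; the graph occupied by Maker is the spanning subgraph of $K_n$ formed by the edges she claimed. $\log$ denotes the natural logarithm. *)

(* Defs.v *)
From mathcomp Require Import all_boot.

Set Implicit Arguments.
Unset Strict Implicit.
Unset Printing Implicit Defensive.

Section Game.
Variables (T : finType) (X : {set T}).

(* A history lists the claimed elements of the board X in the order in which
   they were claimed; Maker moves first, so her moves have even indices. *)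
Definition history (h : seq T) : Prop := uniq h /\ {subset h <= X}.

Definition maker_strategy (s : seq T -> T) : Prop :=
  forall h, history h -> ~~ odd (size h) -> size h < #|X| ->
    s h \in X /\ s h \notin h.

Definition complete_play (p : seq T) : Prop := history p /\ size p = #|X|.

(* Breaker's moves (at odd indices) are unconstrained. *)
Definition follows (s : seq T -> T) (p : seq T) : Prop :=
  forall h x t, p = h ++ x :: t -> ~~ odd (size h) -> x = s h.

Definition maker_claims (p : seq T) : {set T} :=
  [set x in p | ~~ odd (index x p)].

Definition maker_can_achieve (goal : {set T} -> Prop) : Prop :=
  exists2 s, maker_strategy s &
    forall p, complete_play p -> follows s p -> goal (maker_claims p).

End Game.

Section Graphs.
Variables (V : finType).

Definition simple_graph (e : rel V) : Prop := symmetric e /\ irreflexive e.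

Definition connected_graph (e : rel V) : Prop := forall x y, connect e x y.

(* Closed paths of length at most 2 are not cycles of a simple graph. *)
Definition acyclic_graph (e : rel V) : Prop :=
  forall p : seq V, 2 < size p -> ~ ucycle e p.

Definition is_tree (e : rel V) : Prop :=
  [/\ simple_graph e, connected_graph e & acyclic_graph e].

Definition max_degree (e : rel V) : nat := \max_x #|[set y | e x y]|.

Definition complete_edges : {set {set V}} := [set A : {set V} | #|A| == 2].

(* The spanning graph on V with edge set M; for x = y, [set x; y] is a
   singleton and hence not an edge of the complete graph. *)
Definition edge_rel (M : {set {set V}}) : rel V :=
  fun x y => [set x; y] \in M.

End Graphs.

(* Copies need not be induced. *)
Definition contains_copy (V W : finType) (g : rel W) (e : rel V) : Prop :=
  exists2 f : V -> W, injective f & forall x y, e x y -> g (f x) (f y).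

(* Main.v *)
Require Import Defs.
From mathcomp Require Import all_boot all_order all_algebra perm.
From mathcomp Require Import reals sequences exp.
From mathcomp Require Import zify lra.

(** By the Erdos-Selfridge criterion Maker can hit every set of a family F of edge
    sets with total weight sum 2^-|S| < 1.  Applied to certificates of failure,
    this gives a graph g in which any set of C vertices (C a large constant) sends
    many edges to any linear-size set, in which all degrees into a fixed reserved
    set A1 and into the complement of A1 u A2 are linear, and in which some vertex
    x0 has a linear codegree inside A1 with every other vertex.  (Breaker can
    destroy the codegree of any given pair, hence x0 cannot be fixed in advance.)

    A spanning tree is embedded by first removing a linear number of slots:
    either leaves, or middle vertices of bare paths if there are few leaves.  The
    rest is embedded greedily; only boundedly many vertices ever run short of
    free neighbours, and these get reserved sets of neighbours in time.  Finally
    the slots are matched with the unused vertices, which needs a linear minimum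
    degree on both sides and an edge between any two linear-size sets.  That
    every unused vertex suits linearly many slots is ensured by placing some
    neighbours of slots inside A1 in such a way that an
    exponential potential does not increase; the bound n / log n on the degrees is
    what makes the union bound over the n vertices work.  If all of these
    neighbours hang below one tree vertex, that vertex has to be put on x0. *)

Set Implicit Arguments.
Unset Strict Implicit.
Unset Printing Implicit Defensive.

Import Order.TTheory GRing.Theory Num.Theory.

(** * The Erdos-Selfridge criterion *)

(** The constants form a chain. [C] comes first and handles sets of size [a %/ 64]; it fixes the
    codegree constant [L], which fixes how small the threshold [t] of the final matching has to be
    compared with [a]; density for sets of size about [t] then needs a second, much larger constant
    [C2]. The random placement is derandomised. Every test carries a product of factors, each with
    average at most 1 over the admissible places, so each vertex can be placed without raising the
    weighted total over all tests. With leaves as slots the tests are the vertices [w]. Exponents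
    must stay below 1 and are therefore divided by [Delta], which turns the loss [ln n] into
    [Delta * ln n]; this has to be linear. With path vertices as slots, a slot needs a common
    neighbour of two images. Density alone does not give one inside every large set [W] for many
    slots, since both images might be chosen badly. Hence each of the [2 ^ n] sets [W] is a test as
    well, of weight [2 ^ - n], and a failure multiplies its product by a huge constant [K = 2 ^ k];
    at most about [3 n / k] slots can then fail. *)

Section ErdosSelfridge.
Local Open Scope ring_scope.
Variables (R : realFieldType) (T : finType).
Implicit Types (X S : {set T}) (F : {set {set T}}) (h : seq T).

Definition breaker_claims h : {set T} := [set x in h | odd (index x h)].

Definition weight F : R := \sum_(S in F) 2%:R ^- #|S|.

(* The expected number of sets of [F] occupied by Breaker if all unclaimed
   elements were distributed by fair coin flips. *)
Definition potential F h : R :=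
  \sum_(S in F | [disjoint S & maker_claims h])
     2%:R ^- #|S :\: breaker_claims h|.

Definition danger F h x : R :=
  \sum_(S in F | [disjoint S & maker_claims h] && (x \in S))
     2%:R ^- #|S :\: breaker_claims h|.

Lemma index_rcons_notin h x y : x \notin h ->
  index y (rcons h x) = if y \in h then index y h else
     if y == x then size h else (size h).+1.
Proof.
move=> xh; rewrite -cats1 index_cat; case: ifP => //= yh.
by rewrite eq_sym; case: eqP => _; rewrite ?addn0 ?addn1.
Qed.

Lemma maker_claims_rcons h x : x \notin h ->
  maker_claims (rcons h x) =
  if odd (size h) then maker_claims h else x |: maker_claims h.
Proof.
move=> xh; apply/setP=> y.
have yx : y \in h -> y != x by apply: contraTneq => ->.
rewrite inE mem_rcons inE index_rcons_notin //.
case: (boolP (y \in h)) => yh; rewrite ?orbT ?orbF /=.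
  by case: ifP => _; rewrite !inE yh ?(negbTE (yx yh)).
by case: ifP => [/eqP ->|yx']; case: (odd (size h)); rewrite !inE ?eqxx ?(negbTE xh) ?(negbTE yh) ?yx'.
Qed.

Lemma breaker_claims_rcons h x : x \notin h ->
  breaker_claims (rcons h x) =
  if odd (size h) then x |: breaker_claims h else breaker_claims h.
Proof.
move=> xh; apply/setP=> y.
have yx : y \in h -> y != x by apply: contraTneq => ->.
rewrite inE mem_rcons inE index_rcons_notin //.
case: (boolP (y \in h)) => yh; rewrite ?orbT ?orbF /=.
  by case: ifP => _; rewrite !inE yh ?(negbTE (yx yh)).
by case: ifP => [/eqP ->|yx']; case: (odd (size h)); rewrite !inE ?eqxx ?(negbTE xh) ?(negbTE yh) ?yx'.
Qed.

Lemma half_exp_ge0 n : 0 <= (2%:R : R) ^- n.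
Proof. by rewrite invr_ge0 exprn_ge0. Qed.

Lemma disjoint_setU1 (S M : {set T}) x :
  [disjoint S & x |: M] = (x \notin S) && [disjoint S & M].
Proof.
rewrite -!setI_eq0 setIUr setU_eq0; congr (_ && _).
by rewrite setIC setI_eq0 disjoints1.
Qed.

Lemma potential_maker F h x : x \notin h -> ~~ odd (size h) ->
  potential F (rcons h x) = potential F h - danger F h x.
Proof.
move=> xh ev; rewrite /potential /danger.
rewrite maker_claims_rcons // breaker_claims_rcons // (negbTE ev).
rewrite [in RHS](bigID (fun S : {set T} => x \in S)) /=.
set a := (X in _ = X + _ - _); set b := (X in _ = _ + X - _).
set c := (X in _ = _ - X).
have -> : a = c by apply: eq_bigl => S; rewrite andbA.
rewrite addrC addKr; apply: eq_bigl => S.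
rewrite -andbA; congr (_ && _).
by rewrite disjoint_setU1 andbC.
Qed.

Lemma potential_breaker F h x : x \notin h -> odd (size h) ->
  potential F (rcons h x) = potential F h + danger F h x.
Proof.
move=> xh od; rewrite /potential /danger.
rewrite maker_claims_rcons // breaker_claims_rcons // od.
rewrite (bigID (fun S : {set T} => x \in S)) [in RHS](bigID (fun S : {set T} => x \in S)) /=.
rewrite [RHS]addrAC; congr (_ + _); last first.
  apply: eq_bigr => S /andP[_ xS].
  have -> : S :\: (x |: breaker_claims h) = S :\: breaker_claims h => //.
  apply/setP => y; rewrite !in_setD in_setU1 negb_or; case: eqP => //= ->.
  by rewrite (negbTE xS) andbF.
rewrite (eq_bigl (fun i => [&& i \in F, [disjoint i & maker_claims h] & x \in i])); last first.
  by move=> i; rewrite andbA.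
rewrite [X in _ = X + _](eq_bigl (fun i => [&& i \in F, [disjoint i & maker_claims h] & x \in i])); last first.
  by move=> i; rewrite andbA.
rewrite -big_split /=; apply: eq_bigr => S /and3P[_ _ xS].
have -> : S :\: breaker_claims h = x |: (S :\: (x |: breaker_claims h)).
  apply/setP => y; rewrite in_setU1 !in_setD in_setU1 negb_or; case: eqP => //= ->.
  by rewrite xS andbT inE (negbTE xh).
rewrite cardsU1 !inE eqxx /= add1n exprS invfM.
by rewrite -mulrDl -[2^-1]div1r -splitr mul1r.
Qed.

Lemma danger_rcons F h x y : x \notin h -> ~~ odd (size h) ->
  danger F (rcons h x) y <= danger F h y.
Proof.
move=> xh ev; rewrite /danger maker_claims_rcons // breaker_claims_rcons // (negbTE ev).
rewrite [leRHS](bigID (fun S : {set T} => x \in S)) /=.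
rewrite -[leLHS]add0r lerD ?sumr_ge0 // => [S _|]; first exact: half_exp_ge0.
rewrite le_eqVlt; apply/orP; left; apply/eqP; apply: eq_bigl => S; rewrite -!andbA; congr (_ && _).
rewrite disjoint_setU1.
by case: (x \in S); rewrite /= ?andbF ?andbT.
Qed.

Definition es_strategy X F (x0 : T) h : T :=
  if [pick x in X :\: [set y in h]] is Some x1
  then [arg max_(x > x1 in X :\: [set y in h]) danger F h x]%O else x0.

Lemma es_strategyP X F x0 h : history X h -> (size h < #|X|)%N ->
  [/\ es_strategy X F x0 h \in X, es_strategy X F x0 h \notin h
   & forall y, y \in X -> y \notin h -> danger F h y <= danger F h (es_strategy X F x0 h)].
Proof.
move=> [uh hX] sh; rewrite /es_strategy; case: pickP => [x1 x1P|none].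
  case: arg_maxP => // x; rewrite !inE => /andP[xh xX] xmax.
  by split=> // y yX yh; apply: xmax; rewrite !inE yh.
have: X \subset [set y in h].
  by apply/subsetP => x xX; apply: contraFT (none x) => xh; rewrite inE xh.
move/subset_leq_card; rewrite cardsE (card_uniqP uh) => H.
by rewrite ltnNge H in sh.
Qed.

Lemma breaker_claimsE h x : x \in h -> x \notin maker_claims h -> x \in breaker_claims h.
Proof. by rewrite !inE => -> /=; rewrite negbK. Qed.

(** Maker removes the largest danger, and Breaker's reply adds a danger that Maker could have
    removed and that has not grown since. Thus no round raises the potential, whereas a set claimed
    entirely by Breaker would contribute 1 at the end. *)
Lemma erdos_selfridge X F (x0 : T) :
  (forall S, S \in F -> S \subset X) -> weight F < 1 ->
  maker_can_achieve X (fun M => forall S, S \in F -> ~~ [disjoint S & M]).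
Proof.
move=> FX w1; exists (es_strategy X F x0).
  by move=> h hh _ sh; case: (es_strategyP F x0 hh sh).
move=> p [[up pX] sp] fol S SF; apply/negP => dis.
have pot0 : potential F [::] = weight F.
  rewrite /potential /weight; apply: eq_big => [A|A _]; last first.
    have -> // : A :\: breaker_claims [::] = A.
    by apply/setP => y; rewrite in_setD inE.
  rewrite andbC -setI_eq0; have -> : maker_claims ([::] : seq T) = set0 by apply/setP => y; rewrite !inE.
  by rewrite setI0 eqxx.
have hist k : history X (take k p).
  split; first exact: take_uniq.
  by move=> y /mem_take; apply: pX.
have step k : (k < size p)%N -> take k.+1 p = rcons (take k p) (nth x0 p k).
  by move=> ?; rewrite (take_nth x0).
have fresh k : (k < size p)%N -> nth x0 p k \notin take k p.
  by move=> kp; have := take_uniq k.+1 up; rewrite step // rcons_uniq => /andP[].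
have mk k : (k < size p)%N -> ~~ odd k -> nth x0 p k = es_strategy X F x0 (take k p).
  move=> kp ek; apply: (fol _ _ (drop k.+1 p)); last by rewrite size_takel // ltnW.
  by rewrite -drop_nth // cat_take_drop.
have mkdec k : (k < size p)%N -> ~~ odd k ->
    potential F (take k.+1 p) <= potential F (take k p).
  move=> kp ek; rewrite step // potential_maker ?fresh // ?size_takel // ?(ltnW kp) //.
  by rewrite lerBlDr lerDl sumr_ge0 // => ? _; exact: half_exp_ge0.
have main k : (k.*2 <= size p)%N -> potential F (take k.*2 p) <= weight F.
  elim: k => [|k IH]; first by rewrite take0 pot0.
  rewrite doubleS => kp; have kp1 := ltnW kp; apply: le_trans (IH (ltnW kp1)).
  have ev : ~~ odd k.*2 by rewrite odd_double.
  rewrite step // potential_breaker ?fresh //; last by rewrite size_takel //= ev.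
  rewrite {1}step // potential_maker ?fresh //; last by rewrite size_takel // ltnW.
  rewrite -addrA gerDl addrC subr_le0.
  case: (es_strategyP F x0 (hist k.*2)) => [|_ _ mx]; first by rewrite size_takel -?sp // ltnW.
  apply: (@le_trans _ _ (danger F (take k.*2 p) (nth x0 p k.*2.+1))).
    by rewrite step //; apply: danger_rcons; rewrite ?fresh // size_takel // ltnW.
  rewrite (mk k.*2) //; apply: mx; first exact/pX/mem_nth.
  by have := fresh _ kp; rewrite step // mem_rcons inE negb_or => /andP[].
(* On a board of odd size the last move is an unpaired one of Maker, which cannot raise the
   potential. *)
have fin : potential F p <= weight F.
  have hs := odd_double_half (size p); set k := (size p)./2 in hs.
  have [op|ep] := boolP (odd (size p)); rewrite ?op ?(negbTE ep) /= in hs; last first.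
    by have := main k; rewrite take_oversize -hs ?add0n ?leqnn //; apply.
  have lt : (k.*2 < size p)%N by rewrite -hs.
  apply: le_trans (main _ (ltnW lt)).
  have := mkdec _ lt; rewrite odd_double => /(_ isT).
  by rewrite (take_oversize (n := k.*2.+1)) // -hs.
have : 1 <= potential F p.
  rewrite /potential (bigD1 S) ?SF //= -[leLHS]addr0 lerD //; last first.
    by rewrite sumr_ge0 // => ? _; exact: half_exp_ge0.
  have -> : S :\: breaker_claims p = set0; last by rewrite cards0 expr0 invr1.
  apply/setP => x; rewrite inE [RHS]inE; apply/negP => /andP[xb xS].
  have xp : x \in p.
    have : [set y in p] = X.
      apply/eqP; rewrite eqEcard cardsE (card_uniqP up) sp leqnn andbT.
      by apply/subsetP => y; rewrite inE => /pX.
    by move/setP/(_ x); rewrite inE (subsetP (FX _ SF) x xS).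
  by move/negP: xb; apply; apply: breaker_claimsE => //; rewrite (disjointFr dis xS).
by move/le_lt_trans/(_ (le_lt_trans fin w1)); rewrite ltxx.
Qed.
End ErdosSelfridge.

(** * Properties with a certificate family *)

Section EsBound.
Local Open Scope ring_scope.
Variables (R : realFieldType) (T : finType) (X : {set T}).
Implicit Types (P Q : {set T} -> Prop) (eps : R).

(** The members of [F] are certificates of failure: if [P M] fails, Breaker owns one of them. Such
    weights add up under conjunction, so union bounds for random graphs carry over to the game. *)
Definition es_bound P eps : Prop :=
  exists2 F : {set {set T}}, (forall S, S \in F -> S \subset X) &
    weight R F <= eps /\
    forall M : {set T}, (forall S, S \in F -> ~~ [disjoint S & M]) -> P M.

Lemma maker_can_achieve_mono P Q :
  (forall M, P M -> Q M) -> maker_can_achieve X P -> maker_can_achieve X Q.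
Proof. by move=> PQ [s s1 s2]; exists s => // p p1 p2; apply/PQ/s2. Qed.

Lemma es_bound_maker P eps (x0 : T) :
  es_bound P eps -> eps < 1 -> maker_can_achieve X P.
Proof.
move=> [F FX [Fe FP]] e1; apply: maker_can_achieve_mono FP _.
by apply: (erdos_selfridge x0 FX (le_lt_trans Fe e1)).
Qed.

Lemma es_bound_mono P Q eps eps' : (forall M, P M -> Q M) -> eps <= eps' ->
  es_bound P eps -> es_bound Q eps'.
Proof.
move=> PQ ee [F FX [Fe FP]]; exists F => //; split; first exact: le_trans Fe ee.
by move=> M /FP /PQ.
Qed.

Lemma es_bound_forall (I : finType) (D : pred I) (P : I -> {set T} -> Prop) (eps : I -> R) :
  (forall i, D i -> es_bound (P i) (eps i)) ->
  es_bound (fun M => forall i, D i -> P i M) (\sum_(i | D i) eps i).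
Proof.
move=> H.
have /fin_all_exists[F HF] : forall i, exists F : {set {set T}}, D i ->
    [/\ forall S, S \in F -> S \subset X, weight R F <= eps i &
    forall M : {set T}, (forall S, S \in F -> ~~ [disjoint S & M]) -> P i M].
  move=> i; case: (boolP (D i)) => [/H[F ? [? ?]]|nD]; last by exists set0.
  by exists F.
exists (\bigcup_(i | D i) F i) => [S /bigcupP[i Di]|]; first by case: (HF i Di) => + _ _; apply.
split.
  apply: (@le_trans _ _ (\sum_(i | D i) weight R (F i))); last first.
    by apply: ler_sum => i Di; case: (HF i Di).
  rewrite /weight (exchange_big_dep xpredT) //= [leLHS]big_mkcond /=.
  apply: ler_sum => S _; case: ifP => [/bigcupP[i Di Si]|_]; last first.
    by apply: sumr_ge0 => ? _; exact: half_exp_ge0.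
  rewrite (bigD1 i) /= ?Di // lerDl; apply: sumr_ge0 => ? _; exact: half_exp_ge0.
move=> M HM i Di; case: (HF i Di) => _ _; apply=> S Si; apply: HM.
by apply/bigcupP; exists i.
Qed.

Lemma es_bound_and P Q eps eps' :
  es_bound P eps -> es_bound Q eps' -> es_bound (fun M => P M /\ Q M) (eps + eps').
Proof.
move=> HP HQ.
have := @es_bound_forall bool xpredT (fun b => if b then P else Q)
  (fun b => if b then eps else eps').
case; first by case.
move=> F FX [Fe FP]; exists F => //; split; first by move: Fe; rewrite big_bool.
by move=> M /FP H; split; [exact: (H true)|exact: (H false)].
Qed.

(* In a random play Breaker occupies some alternative of a given block with
   probability at most 3/4.  Weighting an unoccupied block by 1/8 turns the
   count of certificates into the product (1/8 + 3/4)^#|K|, and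
   (7/8)^32 <= 8^-2. *)
Lemma es_bound_blocks (K O : finType) (alt : K -> O -> {set T}) (q : nat) :
  (forall k o, alt k o \subset X) ->
  (forall k k' o o', k != k' -> [disjoint alt k o & alt k' o']) ->
  (forall k, \sum_o 2%:R ^- #|alt k o| <= 3%:R / 4%:R :> R) ->
  (32 * q <= #|K|)%N ->
  es_bound (fun M => (q < #|[set k | [forall o, ~~ [disjoint alt k o & M]]]|)%N) (8%:R ^- q).
Proof.
move=> altX dis w34 qK.
(* A certificate names for every block an alternative owned by Breaker, or [None]; at most [q]
   blocks may be [None], those which Maker has hit in every alternative. *)
pose cert (c : {ffun K -> option O}) :=
  \bigcup_k (if c k is Some o then alt k o else set0).
pose none (c : {ffun K -> option O}) := [set k | c k == None].
exists [set cert c | c in [set c | (#|none c| <= q)%N]].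
  move=> S /imsetP[c _ ->]; apply/bigcupsP => k _.
  by case: (c k) => [o|]; rewrite ?altX ?sub0set.
split; last first.
  move=> M HM; rewrite ltnNge; apply/negP => le.
  pose c := [ffun k => [pick o | [disjoint alt k o & M]]].
  have cn : none c = [set k | [forall o, ~~ [disjoint alt k o & M]]].
    apply/setP => k; rewrite !inE ffunE; case: pickP => [o H|H].
      by apply/esym/negbTE/negP => /forallP/(_ o); rewrite H.
    by apply/esym/forallP => o; rewrite H.
  have /HM : cert c \in [set cert c | c in [set c | (#|none c| <= q)%N]].
    by apply: imset_f; rewrite inE cn.
  rewrite -setI_eq0 => /set0Pn[x]; rewrite inE => /andP[/bigcupP[k _]].
  rewrite ffunE; case: pickP => [o H|_]; last by rewrite inE.
  by move=> xa; rewrite (disjointFr H xa).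
have cardc c : #|cert c| = (\sum_k #|if c k is Some o then alt k o else set0|)%N.
  pose G k := if c k is Some o then alt k o else set0.
  have Gd k k' : k != k' -> [disjoint G k & G k'].
    move=> kk'; rewrite /G; case: (c k) => [o|]; last by rewrite -setI_eq0 set0I.
    by case: (c k') => [o'|]; [exact: dis|rewrite -setI_eq0 setI0].
  rewrite -/(cert c) -sum1_card (partition_disjoint_bigcup _ _ Gd).
  by apply: eq_bigr => k _; rewrite sum1_card /G; case: (c k).
pose F (k : K) (x : option O) : R := if x is Some o then 2%:R ^- #|alt k o| else 8%:R^-1.
have F0 k x : 0 <= F k x by case: x => [o|] /=; rewrite ?half_exp_ge0 ?invr_ge0.
have bnd c : (#|none c| <= q)%N -> 2%:R ^- #|cert c| <= 8%:R ^+ q * \prod_k F k (c k).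
  move=> nq; rewrite (bigID (fun k => c k == None)) /=.
  have -> : \prod_(k | c k == None) F k (c k) = 8%:R ^- #|none c|.
    rewrite (eq_bigr (fun=> 8%:R^-1)) => [|k /eqP ->//].
    by rewrite prodr_const exprVn /none cardsE.
  have -> : \prod_(k | c k != None) F k (c k) = 2%:R ^- #|cert c|.
    rewrite cardc [in RHS](bigID (fun k => c k == None)) /= [X in (X + _)%N]big1; last first.
      by move=> k /eqP ->; rewrite cards0.
    by rewrite add0n -prodrXr -prodfV; apply: eq_bigr => k; case: (c k).
  rewrite mulrA ler_peMl ?half_exp_ge0 //.
  rewrite -(subnK nq) exprD mulfK ?expf_neq0 ?pnatr_eq0 //.
  by rewrite exprn_ege1 // ler1n.
apply: (@le_trans _ _ (\sum_(c | (#|none c| <= q)%N) 2%:R ^- #|cert c|)).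
  rewrite /weight.
  apply: (@le_trans _ _ (\sum_(S in [set cert c | c in [set c | (#|none c| <= q)%N]])
      \sum_(c | (#|none c| <= q)%N && (cert c == S)) 2%:R ^- #|cert c|)).
    apply: ler_sum => S /imsetP[c cq ->]; rewrite inE in cq.
    rewrite (bigD1 c) /= ?cq ?eqxx // lerDl.
    by apply: sumr_ge0 => ? _; exact: half_exp_ge0.
  rewrite (exchange_big_dep (fun c => (#|none c| <= q)%N)) /=; last by move=> S c _ /andP[].
  apply: ler_sum => c cq.
  rewrite (big_pred1 (cert c)) // => S; rewrite /= cq /= eq_sym.
  by case: eqP => [->|]; rewrite ?andbF // andbT imset_f // inE.
apply: (@le_trans _ _ (\sum_(c : {ffun K -> option O}) 8%:R ^+ q * \prod_k F k (c k))).
  rewrite [leLHS]big_mkcond /=; apply: ler_sum => c _; case: ifP => [/bnd //|_].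
  by rewrite mulr_ge0 ?exprn_ge0 // prodr_ge0.
rewrite -mulr_sumr -(bigA_distr_bigA F).
have le78 k : \sum_x F k x <= 7%:R / 8%:R.
  rewrite (bigID (fun x => x == None)) /= big_pred1_eq /=.
  have -> : \sum_(x | x != None) F k x = \sum_o 2%:R ^- #|alt k o|.
    rewrite (reindex_omap (Some : O -> option O) id) /=; last by case.
    by apply: eq_bigl => o; rewrite eqxx.
  by have := w34 k; lra.
apply: (@le_trans _ _ (8%:R ^+ q * (7%:R / 8%:R) ^+ (32 * q))).
  rewrite ler_wpM2l ?exprn_ge0 //.
  apply: (@le_trans _ _ ((7%:R / 8%:R) ^+ #|K|)).
    rewrite -prodr_const.
    by apply: ler_prod => k _; rewrite le78 sumr_ge0.
  by apply: ler_wiXn2l => //; lra.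
rewrite exprM -exprMn -exprVn; apply: lerXn2r; rewrite ?nnegrE; [nra| |].
  by rewrite invr_ge0.
have h2 : (7%:R / 8%:R) ^+ 32 = (((((7%:R / 8%:R) ^+ 2) ^+ 2) ^+ 2) ^+ 2) ^+ 2 :> R.
  by rewrite -!exprM.
rewrite h2 !expr2; lra.
Qed.
End EsBound.

(** * Pseudorandom properties of Maker's graph *)

Section GraphProperties.
Local Open Scope ring_scope.
Variables (R : realFieldType) (V : finType).
Implicit Types (M : {set {set V}}) (X Y : {set V}).

Definition neighbors (g : rel V) x : {set V} := [set y | g x y].

(** It is mostly used in the form that fewer than [C] vertices see less than a 1/64 fraction of a
    given large [Y]; the two sets may overlap. *)
Definition dense (g : rel V) (C y0 : nat) : Prop :=
  forall X Y, (C <= #|X|)%N -> (y0 <= #|Y|)%N ->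
    exists2 x, x \in X & (#|Y| <= 64 * #|Y :&: neighbors g x|)%N.

Lemma subset_of_card X k : (k <= #|X|)%N -> exists2 X' : {set V}, X' \subset X & #|X'| = k.
Proof.
move=> kX; have : (0 < #|[set B : {set V} | B \subset X & #|B| == k]|)%N.
  by rewrite cards_draws bin_gt0.
by case/card_gt0P => B; rewrite inE => /andP[BX /eqP cB]; exists B.
Qed.

Lemma card_sets : #|{: {set V}}| = (2 ^ #|V|)%N.
Proof.
rewrite -[#|{: {set V}}|]cardsT -[in RHS](cardsT V) -card_powerset.
by apply: eq_card => A; rewrite !inE subsetT.
Qed.

Lemma edge_rel_sym M : symmetric (edge_rel M).
Proof. by move=> x y; rewrite /edge_rel setUC. Qed.

Lemma set2_complete x y : x != y -> [set x; y] \in complete_edges V.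
Proof. by move=> xy; rewrite inE cards2 xy. Qed.

Lemma set2_inj (a b c d : V) : [set a; b] = [set c; d] ->
  (a = c /\ b = d) \/ (a = d /\ b = c).
Proof.
move=> E; have : [/\ a \in [set c; d], b \in [set c; d], c \in [set a; b] & d \in [set a; b]].
  by rewrite E !set21 !set22 -E !set21 !set22.
rewrite !inE => -[/orP[]/eqP ? /orP[]/eqP ? /orP[]/eqP ? /orP[]/eqP ?]; subst; auto.
Qed.

(** The blocks are the single edges between [X] and [Y], each with one alternative of weight 1/2;
    disjointness makes different pairs different edges. *)
Lemma es_bound_pair X Y q : [disjoint X & Y] -> (32 * q <= #|X| * #|Y|)%N ->
  es_bound (complete_edges V)
    (fun M => (q < \sum_(x in X) #|Y :&: neighbors (edge_rel M) x|)%N) (8%:R ^- q : R).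
Proof.
move=> dXY qXY.
pose K := {p : V * V | p \in setX X Y}.
pose alt (k : K) (_ : unit) := [set [set (val k).1; (val k).2]].
have neXY x y : x \in X -> y \in Y -> x != y.
  by move=> xX yY; apply: contraTneq yY => <-; rewrite (disjointFr dXY xX).
have /es_bound_mono : es_bound (complete_edges V) (fun M =>
   (q < #|[set k | [forall o, ~~ [disjoint alt k o & M]]]|)%N) (8%:R ^- q : R).
  apply: es_bound_blocks.
  - move=> [[x y] /= xy] o; rewrite /alt /= sub1set; apply: set2_complete.
    by move: xy; rewrite inE => /andP[/= xX yY]; exact: neXY.
  - move=> [[x y] xy] [[x' y'] xy'] o o' ne; rewrite /alt /= disjoints1 inE.
    apply: contra ne => /eqP/esym/set2_inj H; apply/eqP/val_inj => /=.
    move: xy xy'; rewrite !inE /= => /andP[xX yY] /andP[x'X y'Y].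
    case: H => [[-> ->]//|[xy' yx']].
    by have := neXY _ _ xX y'Y; have := neXY _ _ x'X yY; rewrite xy' yx' eqxx.
  - by move=> k; rewrite (big_pred1 tt) => [|[]] //; rewrite /alt cards1 expr1; lra.
  - by apply: (leq_trans qXY); rewrite card_sig -cardsX; apply/eq_leq/eq_card => p; rewrite inE.
apply => // M /leq_trans; apply.
set A := [set k | _].
have -> : (\sum_(x in X) #|Y :&: neighbors (edge_rel M) x| =
   #|[set p in setX X Y | edge_rel M p.1 p.2]|)%N.
  rewrite -sum1dep_card (eq_bigl (fun p => (p.1 \in X) && (p.2 \in Y :&: neighbors (edge_rel M) p.1))); last first.
    by move=> [x y]; rewrite !inE /= -andbA.
  rewrite -(pair_big_dep (fun x => x \in X) (fun x y => y \in Y :&: neighbors (edge_rel M) x) (fun _ _ => 1)%N) /=.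
  by apply: eq_bigr => x _; rewrite sum1_card.
rewrite -(card_imset _ val_inj); apply: subset_leq_card; apply/subsetP => p /imsetP[k kA ->].
rewrite inE (valP k) /=; move: kA; rewrite inE => /forallP/(_ tt).
by rewrite /alt disjoints1 negbK.
Qed.

Lemma es_bound_degree Y : es_bound (complete_edges V)
    (fun M => forall x, (#|Y| <= 64 * #|Y :&: neighbors (edge_rel M) x|)%N)
    (#|V|%:R * 8%:R ^- (#|Y|.-1 %/ 32) : R).
Proof.
set q := (_ %/ 32)%N.
have := @es_bound_forall R _ (complete_edges V) V xpredT
  (fun x M => (#|Y| <= 64 * #|Y :&: neighbors (edge_rel M) x|)%N) (fun=> 8%:R ^- q).
rewrite sumr_const mulr_natl.
case; last by move=> F FX [Fe FP]; exists F => //; split => // M /FP H x; exact: H.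
move=> x _.
(* The pair of [x] with itself is no edge, so [x] has to be removed from [Y]; this is the origin of
   the predecessor. *)
have cY : (#|Y|.-1 <= #|Y :\ x|)%N by rewrite [#|Y|](cardsD1 x); case: (x \in Y) => /=; lia.
have := @es_bound_pair [set x] (Y :\ x) q; rewrite disjoints1 !inE eqxx /= => /(_ isT).
rewrite cards1 mul1n => H; apply: es_bound_mono (H _) => //; last by rewrite /q; lia.
move=> M; rewrite big_set1 => lt.
have : (#|(Y :\ x) :&: neighbors (edge_rel M) x| <= #|Y :&: neighbors (edge_rel M) x|)%N.
  by apply: subset_leq_card; apply: setSI; apply: subsetDl.
by move: lt; rewrite /q; lia.
Qed.

(** There are at most [4 ^ n] pairs of sets, and each costs at most [8 ^ - n] because [C * y0 / 64]
    exceeds [n]. Shrinking [X] to [C] vertices and deleting them from [Y] keeps half of [Y]; with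
    the 1/32 from counting edges this gives the factor 64. *)
Lemma es_bound_dense C y0 : (64 * #|V|.+1 <= C * y0)%N -> (2 * C <= y0)%N ->
  es_bound (complete_edges V) (fun M => dense (edge_rel M) C y0) (2%:R ^- #|V| : R).
Proof.
move=> Cy0 C2.
pose D (p : {set V} * {set V}) := [&& #|p.1| == C, (y0 <= 2 * #|p.2|)%N & [disjoint p.1 & p.2]].
pose q (p : {set V} * {set V}) := (#|p.1| * #|p.2| %/ 32)%N.
have := @es_bound_forall R _ (complete_edges V) _ D
  (fun p M => (q p < \sum_(x in p.1) #|p.2 :&: neighbors (edge_rel M) x|)%N)
  (fun p => 8%:R ^- q p).
case.
  by move=> [X Y] /and3P[/= _ _ dis]; apply: es_bound_pair; rewrite // /q /=; lia.
move=> F FX [Fe FP]; exists F => //; split.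
  apply: (le_trans Fe).
  apply: (@le_trans _ _ (\sum_(p : {set V} * {set V}) 8%:R ^- #|V|)).
    rewrite [leLHS]big_mkcond; apply: ler_sum => -[X Y] _; case: ifP => [/and3P[/= /eqP cX cY _]|_].
      rewrite -!exprVn; apply: ler_wiXn2l; rewrite ?invr_ge0 //; first by lra.
      rewrite /q /= cX leq_divRL // -(@leq_pmul2l 2) //.
      rewrite (mulnCA 2 C); apply: leq_trans (leq_mul (leqnn C) cY).
      by apply: leq_trans Cy0; rewrite mulnCA (mulnC 64%N) leq_mul //.
    exact: half_exp_ge0 || by rewrite invr_ge0 exprn_ge0.
  rewrite sumr_const cardT -cardE card_prod.
  rewrite card_sets -[leLHS]mulr_natl natrM !natrX -!exprVn -!exprMn.
  by apply: lerXn2r; rewrite ?nnegrE; lra.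
move=> M /FP H X Y CX yY.
have [X' X'X cX'] := subset_of_card CX.
set Y' := Y :\: X'.
have cY' : (#|Y| <= #|Y'| + C)%N.
  by rewrite -cX' -(cardsID X' Y) addnC leq_add2l subset_leq_card // subsetIr.
have : D (X', Y') by rewrite /D /= cX' eqxx disjoint_sym disjoints_subset subDset setUCr subsetT andbT; lia.
move/H; rewrite /q /= cX' => lt.
have [/existsP[x /andP[xX' cx]]|/existsPn none] :=
    boolP [exists x, (x \in X') && (#|Y'| <= 32 * #|Y' :&: neighbors (edge_rel M) x|)%N].
  exists x; first exact: (subsetP X'X).
  have : (#|Y' :&: neighbors (edge_rel M) x| <= #|Y :&: neighbors (edge_rel M) x|)%N.
    by apply: subset_leq_card; apply: setSI; apply: subsetDl.
  by lia.
have : (32 * \sum_(x in X') #|Y' :&: neighbors (edge_rel M) x| <= C * #|Y'|)%N.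
  rewrite big_distrr /= -cX' -sum_nat_const; apply: leq_sum => x xX'.
  by have := none x; rewrite xX' /= -ltnNge => /ltnW.
by lia.
Qed.

(* The blocks are the pairs of x-vertices [x_i, x_j].  Breaker keeps the pairs
   (x_i, w_i) and (x_j, w_j) from gaining a common neighbour inside this block
   only by taking x_i x_j, or both w_j x_i and w_i x_j. *)
Lemma es_bound_cherry h : es_bound (complete_edges V)
  (fun M => forall x w : {ffun bool * 'I_h -> V}, injective x -> injective w ->
     (forall a b, x a != w b) ->
     (h * h %/ 32 < #|[set p : 'I_h * 'I_h |
        edge_rel M (x (true, p.1)) (x (false, p.2)) &&
        (edge_rel M (w (false, p.2)) (x (true, p.1)) ||
         edge_rel M (w (true, p.1)) (x (false, p.2)))]|)%N)
  ((#|V| ^ (4 * h))%:R * 8%:R ^- (h * h %/ 32) : R).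
Proof.
set q := (_ %/ 32)%N.
pose I := ({ffun bool * 'I_h -> V} * {ffun bool * 'I_h -> V})%type.
pose D (p : I) := [&& injectiveb p.1, injectiveb p.2 & [forall a, forall b, p.1 a != p.2 b]].
pose cherries (p : I) M := [set k : 'I_h * 'I_h |
        edge_rel M (p.1 (true, k.1)) (p.1 (false, k.2)) &&
        (edge_rel M (p.2 (false, k.2)) (p.1 (true, k.1)) ||
         edge_rel M (p.2 (true, k.1)) (p.1 (false, k.2)))].
have := @es_bound_forall R _ (complete_edges V) I D
  (fun p M => (q < #|cherries p M|)%N) (fun=> 8%:R ^- q).
case; last first.
  move=> F FX [Fe FP]; exists F => //; split; last first.
    move=> M /FP H x w xi wi xw; apply: (H (x, w)); apply/and3P; split; try exact/injectiveP.
    by apply/forallP => a; apply/forallP => b; exact: xw.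
  apply: (le_trans Fe); rewrite sumr_const -[leLHS]mulr_natl ler_wpM2r ?invr_ge0 ?exprn_ge0 //.
  rewrite ler_nat; apply: (leq_trans (max_card _)).
  rewrite card_prod !card_ffun -expnD card_prod card_bool card_ord.
  by apply/eq_leq; congr (_ ^ _)%N; lia.
move=> [x w] /and3P[/= /injectiveP xi /injectiveP wi /forallP xw].
have {}xw a b : x a != w b by have /forallP := xw a; apply.
(* Every edge in an alternative of the block of [i] and [j] has one end labelled [i] and one
   labelled [j], so it determines its block and distinct blocks are disjoint. *)
pose lab v := [pick a | (x a == v) || (w a == v)].
have labx a : lab (x a) = Some a.
  rewrite /lab; case: pickP => [b /orP[/eqP/xi->//|/eqP E]|/(_ a)]; last by rewrite eqxx.
  by have := xw a b; rewrite E eqxx.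
have labw a : lab (w a) = Some a.
  rewrite /lab; case: pickP => [b /orP[/eqP E|/eqP/wi->//]|/(_ a)]; last by rewrite eqxx orbT.
  by have := xw b a; rewrite E eqxx.
pose alt (k : 'I_h * 'I_h) (b : bool) : {set {set V}} :=
  let i := (true, k.1) in let j := (false, k.2) in
  if b then [set [set x i; x j]] else [set [set w j; x i]; [set w i; x j]].
have altlab k b A : A \in alt k b -> lab @: A = [set Some (true, k.1); Some (false, k.2)].
  rewrite /alt; case: b; first by rewrite inE => /eqP ->; rewrite imsetU1 imset_set1 !labx.
  rewrite !inE => /orP[]/eqP ->; rewrite imsetU1 imset_set1 labx labw //.
  by rewrite setUC.
have /es_bound_mono : es_bound (complete_edges V) (fun M =>
   (q < #|[set k | [forall o, ~~ [disjoint alt k o & M]]]|)%N) (8%:R ^- q : R).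
  apply: es_bound_blocks.
  - move=> k b; apply/subsetP => A; rewrite /alt.
    case: b; rewrite !inE; first by move=> /eqP ->; rewrite cards2 (inj_eq xi).
    by case/orP => /eqP ->; rewrite cards2 (eq_sym (w _)) xw.
  - move=> k k' b b' ne; rewrite -setI_eq0; apply: contraR ne => /set0Pn[A].
    rewrite inE => /andP[/altlab E /altlab]; rewrite {}E => E.
    have : Some (true, k.1) \in [set Some (true, k'.1); Some (false, k'.2)] by rewrite -E set21.
    have : Some (false, k.2) \in [set Some (true, k'.1); Some (false, k'.2)] by rewrite -E set22.
    rewrite !inE /= => /eqP[e2]; rewrite orbF => /eqP[e1].
    by case: k k' e1 e2 {E} => [? ?] [? ?] /= -> ->.
  - move=> k; rewrite big_bool /alt /= cards1 cards2.
    have -> /= : [set w (false, k.2); x (true, k.1)] != [set w (true, k.1); x (false, k.2)].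
      apply/eqP => /set2_inj[[/wi//]|[E _]]; by have := xw (false, k.2) (false, k.2); rewrite E eqxx.
    by lra.
  - by rewrite card_prod card_ord /q; lia.
apply => // M /leq_trans; apply; apply: subset_leq_card; apply/subsetP => k.
rewrite !inE => /forallP H; apply/andP; split; first by have := H true; rewrite disjoints1 negbK.
have := H false; rewrite -setI_eq0 => /set0Pn[A]; rewrite !inE /edge_rel.
by case/andP => /orP[]/eqP-> ->; rewrite ?orbT.
Qed.
End GraphProperties.

(** * Completing an embedding; rooted trees *)

Lemma extend_injection (U V : finType) (D : {set U}) (f0 : U -> V) :
  #|U| = #|V| -> {in D &, injective f0} ->
  exists f : {ffun U -> V}, injective f /\ {in D, f =1 f0}.
Proof.
move=> cUV inj0; pose W := ~: (f0 @: D).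
have cW : #|W| = #|~: D|.
  by have := cardsC D; have := cardsC (f0 @: D); rewrite (card_in_imset inj0) -/W cUV; lia.
pose f := [ffun u => if u \in D then f0 u else nth (f0 u) (enum W) (index u (enum (~: D)))].
have lt u : u \notin D -> index u (enum (~: D)) < size (enum W).
  by move=> uD; rewrite -cardE cW cardE index_mem mem_enum inE.
have fW u : u \notin D -> f u \in W.
  by move=> uD; rewrite ffunE (negbTE uD) -mem_enum mem_nth ?lt.
exists f; split; last by move=> u uD; rewrite ffunE uD.
move=> u v; case: (boolP (u \in D)) (boolP (v \in D)) => uD [] vD E.
- by move: E; rewrite !ffunE uD vD; apply: inj0.
- by move: (fW _ vD); rewrite -E ffunE uD inE imset_f.
- by move: (fW _ uD); rewrite E ffunE vD inE imset_f.
move: E; rewrite !ffunE (negbTE uD) (negbTE vD) (set_nth_default (f0 u)) ?lt //.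
move/eqP; rewrite nth_uniq ?enum_uniq ?lt // => /eqP E.
by rewrite -(nth_index u (s := enum (~: D)) (x := u)) ?E ?nth_index // mem_enum inE.
Qed.

(* Among the injective extensions of [f0] take one with the most good slots.
   If [s] is bad, pick [s'] whose current vertex suits [s] and [t] which suits
   the vertex of [s], with the vertex of [t] suiting [s']; rotating these three
   makes [s] good and spoils nothing. *)
Lemma complete_matching (U V : finType) (D : {set U}) (f0 : U -> V) (ok : U -> V -> bool) d :
  #|U| = #|V| -> {in D &, injective f0} ->
  (forall i, i \notin D -> d <= #|[set w in ~: (f0 @: D) | ok i w]|) ->
  (forall w, w \notin f0 @: D -> d <= #|[set i in ~: D | ok i w]|) ->
  (forall (S : {set U}) (W : {set V}), S \subset ~: D -> W \subset ~: (f0 @: D) ->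
     d <= #|S| -> d <= #|W| -> exists i w, [/\ i \in S, w \in W & ok i w]) ->
  exists f : U -> V, [/\ injective f, {in D, f =1 f0} & forall i, i \notin D -> ok i (f i)].
Proof.
move=> cUV inj0 degU degV hole.
pose ext (f : {ffun U -> V}) := injectiveb f && [forall (i | i \in D), f i == f0 i].
pose good (f : {ffun U -> V}) := [set i in ~: D | ok i (f i)].
have [f1 f1ext] : exists f, ext f.
  have [f [fi fD]] := extend_injection cUV inj0; exists f; apply/andP; split; first exact/injectiveP.
  by apply/forall_inP => i /fD ->.
case: (arg_maxnP (fun f => #|good f|) f1ext) => f /andP[/injectiveP fi /forall_inP fD] fmax.
have {}fD : {in D, f =1 f0} by move=> i /fD /eqP.
exists f; split => // s sD; apply: contraT => bad.
have improve (f' : {ffun U -> V}) : injective f' -> {in D, f' =1 f} -> ok s (f' s) ->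
    (forall i, i \in good f -> ok i (f' i)) -> false.
  move=> f'i f'D f's f'g.
  have : ext f'.
    apply/andP; split; first exact/injectiveP.
    by apply/forall_inP => i iD; rewrite f'D // fD.
  move/fmax; rewrite /geq /= => le; suff : #|good f| < #|good f'| by rewrite ltnNge le.
  have: s |: good f \subset good f'.
    apply/subsetP => i; rewrite !inE => /orP[/eqP->|/andP[iD oki]]; first by rewrite sD.
    by rewrite iD f'g // !inE iD.
  by move/subset_leq_card; rewrite cardsU1 !inE sD (negbTE bad).
have surj w : exists i, f i = w.
  by have [g fg gf] := inj_card_bij fi (eq_leq (esym cUV)); exists (g w).
have pool w : w \notin f0 @: D -> exists2 i, i \notin D & f i = w.
  move=> wD; have [i E] := surj w; exists i => //; apply: contra wD => iD.
  by rewrite -E fD // imset_f.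
have fpool i : i \notin D -> f i \in ~: (f0 @: D).
  move=> iD; rewrite inE; apply: contra iD => /imsetP[j jD]; rewrite -fD // => /fi ->.
  by [].
pose S := [set i in ~: D | ok s (f i)].
pose Tt := [set i in ~: D | ok i (f s)].
have cS : d <= #|S|.
  apply: leq_trans (degU s sD) _; rewrite -(card_imset (mem S) fi).
  apply: subset_leq_card; apply/subsetP => w; rewrite !inE => /andP[/pool[i iD <-] oksw].
  by apply: imset_f; rewrite !inE iD.
have cT : d <= #|f @: Tt|.
  by rewrite card_imset //; apply: degV; have := fpool s sD; rewrite inE.
have [||s' [w []]] := hole S (f @: Tt) _ _ cS cT.
- by apply/subsetP => i; rewrite inE => /andP[].
- by apply/subsetP => w /imsetP[i]; rewrite !inE => /andP[iD _] ->; have := fpool i iD; rewrite inE.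
rewrite !inE => /andP[s'D oks'] /imsetP[t]; rewrite !inE => /andP[tD okt] -> okt'.
have ss' : s != s' by apply: contraNneq bad => E; rewrite {2}E.
have st : s != t by apply: contraNneq bad => E; rewrite {1}E.
have neqD i j : i \in D -> j \notin D -> (j == i) = false.
  by move=> iD jD; apply: contraNF jD => /eqP ->.
(* If [s' = t], the rotation degenerates to a swap of [s] and [s']. *)
have [E|s't] := eqVneq s' t.
  apply: (improve [ffun i => f (tperm s s' i)]).
  - by move=> i j; rewrite !ffunE => /fi /perm_inj.
  - by move=> i iD; rewrite ffunE tpermD // neqD.
  - by rewrite ffunE tpermL.
  - move=> i; rewrite !inE ffunE => /andP[_ oki].
    have is_ : i != s by apply: contraNneq bad => <-.
    by case: tpermP => [E'|-> |//]; [rewrite E' eqxx in is_|rewrite E].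
apply: (improve [ffun i => f (tperm s t (tperm s s' i))]).
- by move=> i j; rewrite !ffunE => /fi /perm_inj /perm_inj.
- by move=> i iD; rewrite ffunE !tpermD // neqD.
- by rewrite ffunE tpermL tpermD // eq_sym.
- move=> i; rewrite !inE ffunE => /andP[_ oki].
  have is_ : i != s by apply: contraNneq bad => <-.
  have [->|is'] := eqVneq i s'; first by rewrite tpermR tpermL.
  rewrite (tpermD (x := s) (y := s')) 1?eq_sym //.
  have [->|it] := eqVneq i t; first by rewrite tpermR.
  by rewrite tpermD 1?eq_sym.
Qed.

(** The value of [par] at [r] is a default, so counts of children have to exclude [r]. The last
    clause says that there are no edges besides those to parents. *)
Definition rooted_at (U : finType) (e : rel U) (r : U) (par : U -> U) (dep : U -> nat) : Prop :=
    [/\ par r = r, dep r = 0, forall x, x != r -> e x (par x) /\ dep x = (dep (par x)).+1 &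
     forall x y, e x y -> (x != r /\ y = par x) \/ (y != r /\ x = par y)].

(** Parents come from shortest paths to [r]. If some edge did not join a vertex to its parent,
    deleting it would leave every vertex connected to [r] along parents, and a path between its ends
    would close to a cycle. *)
Lemma rooted_tree (U : finType) (e : rel U) (r : U) : is_tree e ->
  exists (par : U -> U) (dep : U -> nat), rooted_at e r par dep.
Proof.
move=> [[sym irr] conn acyc].
have ex_walk x : exists n, [exists p : n.-tuple U, path e r p && (last r p == x)].
  have /connectP[p pth lst] := conn r x.
  by exists (size p); apply/existsP; exists (in_tuple p); rewrite /= pth lst eqxx.
pose dep x := ex_minn (ex_walk x).
have depP x : exists p, [/\ path e r p, last r p = x & size p = dep x].
  rewrite /dep; case: ex_minnP => n /existsP[p /andP[pth /eqP lst]] _.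
  by exists p; rewrite size_tuple.
have dep_min p x : path e r p -> last r p = x -> dep x <= size p.
  move=> pth lst; rewrite /dep; case: ex_minnP => n _; apply.
  by apply/existsP; exists (in_tuple p); rewrite /= pth lst eqxx.
have dep0 : dep r = 0 by apply/eqP; rewrite -leqn0; apply: (dep_min [::]).
have ex_par x : exists y, if x == r then y == r else e x y && (dep x == (dep y).+1).
  case: eqP => [_|xr]; first by exists r.
  have [p [pth lst sz]] := depP x.
  case/lastP: p pth lst sz => [|p z]; first by move=> _ /= E; case: xr.
  rewrite last_rcons rcons_path size_rcons => /andP[pth ez] zx sz; subst z.
  exists (last r p); rewrite sym ez -sz eqSS eqn_leq (dep_min p) // andbT.
  have [p' [pth' lst' sz']] := depP (last r p).
  rewrite -ltnS sz -sz' -(size_rcons p' x); apply: dep_min; last by rewrite last_rcons.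
  by rewrite rcons_path pth' lst' ez.
have [par parP] := fin_all_exists ex_par.
exists par, dep; split=> //.
- by have := parP r; rewrite eqxx => /eqP.
- by move=> x xr; have := parP x; rewrite (negbTE xr) => /andP[-> /eqP].
have {}parP x : x != r -> e x (par x) /\ dep x = (dep (par x)).+1.
  by move=> xr; have := parP x; rewrite (negbTE xr) => /andP[-> /eqP].
move=> x y exy.
have [|nx] := boolP ((x != r) && (y == par x)); first by move=> /andP[? /eqP]; left.
have [|ny] := boolP ((y != r) && (x == par y)); first by move=> /andP[? /eqP]; right.
pose e' u v := [&& e u v, ~~ ((u == x) && (v == y)) & ~~ ((u == y) && (v == x))].
have e'sym : symmetric e'.
  by move=> u v; rewrite /e' sym; congr (_ && _); rewrite andbC [(v == y) && _]andbC [(v == x) && _]andbC.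
have e'par z : z != r -> e' z (par z).
  move=> zr; rewrite /e' (parP _ zr).1 /=; apply/andP; split.
    by apply: contra nx => /andP[/eqP <- /eqP <-]; rewrite zr eqxx.
  by apply: contra ny => /andP[/eqP <- /eqP <-]; rewrite zr eqxx.
have e'root z : connect e' z r.
  have [n] := ubnP (dep z); elim: n z => // n IH z.
  have [-> //|zr] := eqVneq z r.
  rewrite (parP _ zr).2 ltnS => lt; apply: connect_trans (connect1 (e'par _ zr)) (IH _ lt).
have : connect e' x y.
  by apply: connect_trans (e'root x) _; rewrite (sym_connect_sym e'sym).
case/connectP => p /shortenP[p' pth' un' _] lst.
exfalso; apply: (acyc (x :: p')).
  case: p' pth' un' lst => [|a [|b p']] //=; first by move=> _ _ E; rewrite E irr in exy.
  by rewrite /e' => /andP[/and3P[_ n1 _] _] _ E; rewrite -E !eqxx in n1.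
rewrite /ucycle un' andbT /= rcons_path -lst sym exy andbT.
by apply: sub_path pth' => u v /and3P[].
Qed.

(** * Greedy embedding with reservations *)

Section Reservations.
Variables (V : finType) (g : rel V) (A : {set V}) (Delta C theta z : nat).
Hypothesis C_gt0 : 0 < C.
Hypothesis g_dense : dense g C z.
Hypothesis theta_le : 64 * theta <= z.
Hypothesis theta_ge : C.+1 * Delta.+1 <= theta.
Implicit Types (B P : {set V}) (k : V -> nat) (S : V -> {set V}).

Definition free B S : {set V} := ~: (A :|: B :|: \bigcup_x S x).

(* [P] collects the vertices which have (or had) dangerously few free
   neighbours; each of them owns a private set [S x] of neighbours, large enough
   for the children it still has to receive ([k x] of them are embedded).
   As the free set only shrinks, all of [P] has few neighbours in the final
   free set, so density keeps [P] smaller than [C]. *)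
Definition reservation B k P S : Prop :=
  [/\ #|P| < C,
      forall x, #|S x| <= (if x \in P then Delta else 0) /\ S x \subset neighbors g x :\: (A :|: B),
      forall x, x \in P -> Delta <= #|S x| + k x,
      forall x x' y, y \in S x -> y \in S x' -> x = x' &
      forall x, if x \in P then #|free B S :&: neighbors g x| < theta
                else theta <= #|free B S :&: neighbors g x| + #|P| * Delta.+1].

Lemma reservation0 B : (forall x, theta + #|B| <= #|neighbors g x :\: A|) ->
  reservation B (fun=> 0) set0 (fun=> set0).
Proof.
move=> deg; split.
- by rewrite cards0.
- by move=> x; rewrite inE cards0 sub0set.
- by move=> x; rewrite inE.
- by move=> x x' y; rewrite inE.
move=> x; rewrite inE cards0 mul0n addn0 /free big1 // setU0.
have -> : ~: (A :|: B) :&: neighbors g x = (neighbors g x :\: A) :\: B.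
  by apply/setP => y; rewrite !inE; case: (y \in A); case: (y \in B); rewrite ?andbT ?andbF.
have := deg x; rewrite -(cardsID B (neighbors g x :\: A)).
by have := subset_leq_card (subsetIr (neighbors g x :\: A) B); lia.
Qed.

(** Vertices of [A] are never free, so using one of them changes no requirement. *)
Lemma reservation_in_A B k P S y : y \in A -> reservation B k P S ->
  reservation (y |: B) k P S.
Proof.
move=> yA.
have AB : A :|: (y |: B) = A :|: B.
  by apply/setP => x; rewrite !inE; case: eqP => // ->; rewrite yA.
by rewrite /reservation /free AB.
Qed.

Lemma card_reserved P S : (forall x, #|S x| <= (if x \in P then Delta else 0)) ->
  #|\bigcup_x S x| <= #|P| * Delta.
Proof.
move=> H; apply: (@leq_trans (\sum_x #|S x|)).
  elim/big_rec2: _ => [|x m B' _ le]; first by rewrite cards0.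
  by apply: leq_trans (leq_card_setU _ _) _; rewrite leq_add2l.
apply: (@leq_trans (\sum_x if x \in P then Delta else 0)); first by apply: leq_sum => x _.
by rewrite -big_mkcond /= sum_nat_const.
Qed.

(** A child of [x] takes a private neighbour if [x] is in [P], and otherwise a free one, which
    exists because [theta] exceeds the slack [#|P| * Delta.+1]. *)
Lemma reservation_step B k P S x :
  reservation B k P S -> k x < Delta ->
  #|A :|: B| + C * Delta + z < #|V| ->
  exists y P' S', [/\ g x y, y \notin A :|: B &
    reservation (y |: B) (fun x' => k x' + (x' == x)) P' S'].
Proof.
move=> [PC Ssub Sk Sdis Sfree] kx room.
have [xP|xP] := boolP (x \in P).
  have /card_gt0P[y yS] : 0 < #|S x| by have := Sk _ xP; lia.
  have /subsetP/(_ _ yS) := (Ssub x).2; rewrite !inE => /andP[yAB gxy].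
  exists y, P, (fun x' => S x' :\ y); split => //; first by rewrite inE.
  have fr : free (y |: B) (fun x' => S x' :\ y) = free B S.
    apply/setP => w; rewrite /free !inE; congr (~~ _).
    have [->|wy] := eqVneq w y.
      by rewrite /= orbT /= orbC; apply/esym/orP; left; apply/bigcupP; exists x.
    rewrite /=; congr (_ || _); apply/bigcupP/bigcupP => -[x' _ wS]; exists x' => //.
      by move: wS; rewrite inE => /andP[].
    by rewrite inE wS inE wy.
  split=> //.
  - move=> x'; split; first by apply: leq_trans (subset_leq_card _) (Ssub x').1; apply: subsetDl.
    apply/subsetP => w; rewrite !inE => /andP[wy wS].
    by have /subsetP/(_ _ wS) := (Ssub x').2; rewrite !inE (negbTE wy).
  - move=> x' x'P; have := Sk _ x'P; rewrite (cardsD1 y (S x')).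
    have [->|ne] := eqVneq x' x; first by case: (y \in S x); lia.
    have -> : (y \in S x') = false by apply: contraNF ne => yS'; apply/eqP; exact: Sdis yS' yS.
    by lia.
  - by move=> u u' w; rewrite !inE => /andP[_ wu] /andP[_ wu']; apply: Sdis wu wu'.
  - by rewrite fr.
have dx : 0 < #|free B S :&: neighbors g x|.
  have := Sfree x; rewrite (negbTE xP); suff : #|P| * Delta.+1 < theta by lia.
  by apply: leq_trans theta_ge; rewrite ltn_mul2r /= ltnS ltnW.
case/card_gt0P: dx => y; rewrite !inE => /andP[yfree gxy].
have yAB : y \notin A :|: B by apply: contra yfree => yAB; rewrite !inE in yAB; rewrite yAB.
have yS x' : y \notin S x' by apply: contra yfree => yS; apply/orP; right; apply/bigcupP; exists x'.
have S'sub x' : S x' \subset neighbors g x' :\: (A :|: (y |: B)).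
  apply/subsetP => w wS; have /subsetP/(_ _ wS) := (Ssub x').2; rewrite !inE.
  by case: eqP => // wy; have := yS x'; rewrite -wy wS.
have fr1 : free (y |: B) S = free B S :\ y.
  by apply/setP => w; rewrite !inE; case: eqP => //= _; rewrite ?orbT.
have drop1 x' : #|free B S :&: neighbors g x'| <= #|free (y |: B) S :&: neighbors g x'| + 1.
  rewrite fr1 [in leqLHS](cardsD1 y) addnC; apply: leq_add; last by case: (_ \in _).
  by apply: subset_leq_card; apply/subsetP => w; rewrite !inE => /and3P[-> -> ->].
have poor1 x' : x' \in P -> #|free (y |: B) S :&: neighbors g x'| < theta.
  move=> x'P; have := Sfree x'; rewrite x'P; apply: leq_ltn_trans.
  by apply: subset_leq_card; apply: setSI; rewrite fr1 subsetDl.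
(* One newcomer per step suffices, however many vertices run short: the others lose at most [y] and
   the [Delta] vertices reserved for [x1], while the slack grows by exactly [Delta.+1]. *)
have [/existsP[x1 /andP[x1P x1poor]]|/existsPn none] := boolP [exists x1, (x1 \notin P) &&
    (#|free (y |: B) S :&: neighbors g x1| + #|P| * Delta.+1 < theta)]; last first.
  exists y, P, S; split => //; split=> //.
  - by move=> x'; split => //; exact: (Ssub x').1.
  - by move=> x' /Sk; lia.
  move=> x'; case: ifP => [/poor1 //|x'P].
  by have := none x'; rewrite x'P /= -leqNgt.
have [Q Qsub cQ] : exists2 Q : {set V}, Q \subset free (y |: B) S :&: neighbors g x1 & #|Q| = Delta.
  apply: subset_of_card; have := Sfree x1; rewrite (negbTE x1P) => H.
  have := drop1 x1; suff : #|P| * Delta.+1 + Delta.+1 <= theta by lia.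
  apply: leq_trans theta_ge; rewrite -mulSnr leq_mul2r.
  by rewrite (leqW PC) orbT.
pose S' x' := if x' == x1 then Q else S x'.
have Qfree w : w \in Q -> [/\ w \notin A, w != y, w \notin B, forall x', w \notin S x' & g x1 w].
  move/(subsetP Qsub); rewrite !inE !negb_or => /andP[/andP[/and3P[wA wy wB] wS] gw]; split => // x'.
  by apply: contra wS => wS; apply/bigcupP; exists x'.
have Sx1 : S x1 = set0.
  by apply/eqP; rewrite -cards_eq0 -leqn0; have := (Ssub x1).1; rewrite (negbTE x1P).
have fr2 : free (y |: B) S' = free (y |: B) S :\: Q.
  apply/setP => w; rewrite /free [in RHS]inE ![in LHS]inE ![in RHS]inE -negb_or; congr (~~ _).
  rewrite [RHS]orbCA; congr (_ || _).
  apply/bigcupP/orP => [[x' _]|[wQ|/bigcupP[x' _ wS]]].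
  - by rewrite /S'; case: eqP => _ H; [left|right; apply/bigcupP; exists x'].
  - by exists x1 => //; rewrite /S' eqxx.
  by exists x' => //; rewrite /S'; case: eqP => // E; rewrite E Sx1 inE in wS.
have S'card x' : #|S' x'| <= (if x' \in x1 |: P then Delta else 0).
  rewrite /S' !inE; case: eqP => [_|_] /=; first by rewrite cQ.
  exact: (Ssub x').1.
have poor2 x' : x' \in x1 |: P -> #|free (y |: B) S' :&: neighbors g x'| < theta.
  move=> x'P; apply: (@leq_ltn_trans #|free (y |: B) S :&: neighbors g x'|).
    by apply: subset_leq_card; apply: setSI; rewrite fr2 subsetDl.
  move: x'P; rewrite !inE => /orP[/eqP ->|/poor1 //]; lia.
have P'C : #|x1 |: P| < C.
  rewrite ltnNge; apply/negP => CP'.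
  have P'le : #|x1 |: P| <= C by rewrite cardsU1 x1P add1n.
  have zF : z <= #|free (y |: B) S'|.
    have := cardsC (A :|: (y |: B) :|: \bigcup_x S' x); rewrite -/(free _ _).
    suff : #|A :|: (y |: B) :|: \bigcup_x S' x| <= #|A :|: B|.+1 + C * Delta by lia.
    apply: leq_trans (leq_card_setU _ _) (leq_add _ _).
      by rewrite setUCA cardsU1 yAB.
    by apply: leq_trans (card_reserved S'card) _; rewrite leq_mul2r P'le orbT.
  have [x' x'P le] := g_dense CP' zF.
  by have := poor2 _ x'P; lia.
exists y, (x1 |: P), S'; split => //; split => //.
- move=> x'; split => //; rewrite /S'; case: eqP => [->|_ //].
  by apply/subsetP => w /Qfree[wA wy wB _ gw]; rewrite !inE negb_or wA negb_or wy wB.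
- move=> x'; rewrite !inE /S'; case: eqP => [_ _|_ /= /Sk]; first by rewrite cQ leq_addr.
  by lia.
- move=> u u' w; rewrite /S'; do 2!case: eqP => [->|_] //.
  + by move=> /Qfree[_ _ _ /(_ u')/negP].
  + by move=> + /Qfree[_ _ _ /(_ u)/negP].
  exact: Sdis.
move=> x'; case: ifP => [/poor2 //|]; rewrite !inE => /norP[x'x1 x'P].
have := Sfree x'; rewrite (negbTE x'P) cardsU1 x1P add1n mulSn => H.
have := drop1 x'.
suff : #|free (y |: B) S :&: neighbors g x'| <= #|free (y |: B) S' :&: neighbors g x'| + Delta by lia.
rewrite fr2 -(cardsID Q (_ :&: _)) addnC -cQ leq_add ?subset_leq_card ?subsetIr //.
by apply/subsetP => w; rewrite !inE => /and3P[-> -> ->].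
Qed.
End Reservations.

(** * Greedy embedding that keeps an exponential potential bounded *)

Section TreeEmbedding.
Local Open Scope ring_scope.
Variables (R : realFieldType).

(** The method of conditional expectations: if every test has average at most 1, one choice is good
    for the weighted sum of all tests at once. *)
Lemma averaging (Y Th : finType) (S : {set Y}) (om : Th -> R) (phi : Y -> Th -> R) :
  (0 < #|S|)%N -> (forall t, 0 <= om t) ->
  (forall t, \sum_(y in S) phi y t <= #|S|%:R) ->
  exists2 y, y \in S & \sum_t om t * phi y t <= \sum_t om t.
Proof.
move=> S0 om0 avg; apply/exists_inP; apply: contraT => /exists_inPn none.
suff : \sum_(y in S) \sum_t om t < \sum_(y in S) \sum_t om t * phi y t.
  rewrite exchange_big /= ltNge; case/negP.
  rewrite exchange_big /=; apply: ler_sum => t _.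
  rewrite -mulr_sumr sumr_const -mulr_natr; exact: ler_wpM2l.
apply: ltr_sum => [|y yS]; first by case/card_gt0P: S0 => y yS; apply/hasP; exists y; rewrite ?mem_index_enum.
by rewrite ltNge none.
Qed.

Variables (U V Th : finType) (g : rel V).
Variables (D : {set U}) (r : U) (pred : U -> U) (rk : U -> nat).
(* A vertex [v] of [spec] is placed in [O v x], where [x] is the image of
   [pred v]; this need not make the two images adjacent.  All other vertices
   stay outside of the reserved sets [A true] and [A false]. *)
Variables (spec : {set U}) (O : U -> V -> {set V}) (cls : U -> bool) (A : bool -> {set V}).
Variables (phi : U -> V -> V -> Th -> R) (om : Th -> R) (x0 : V) (Delta C theta z : nat).
Hypothesis rD : r \in D.
Hypothesis r_spec : r \notin spec.
Hypothesis specD : spec \subset D.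
Hypothesis predP : forall v, v \in D -> v != r -> pred v \in D /\ (rk (pred v) < rk v)%N.
Hypothesis kids : forall u, u \in D -> (#|[set v in D :\ r :\: spec | pred v == u]| <= Delta)%N.
Hypothesis disA : [disjoint A true & A false].
Hypothesis OA : forall v x, v \in spec -> O v x \subset A (cls v).
Hypothesis phi_ge0 : forall v x y t, 0 <= phi v x y t.
Hypothesis om_ge0 : forall t, 0 <= om t.
Hypothesis avg : forall v x (B : {set V}), v \in spec ->
  (#|B :&: A (cls v)| <= #|[set u in spec | cls u == cls v]|)%N ->
  (0 < #|O v x :\: B|)%N /\
  forall t, \sum_(y in O v x :\: B) phi v x y t <= #|O v x :\: B|%:R.
Hypothesis C_gt0 : (0 < C)%N.
Hypothesis g_dense : dense g C z.
Hypothesis theta_le : (64 * theta <= z)%N.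
Hypothesis theta_ge : (C.+1 * Delta.+1 <= theta)%N.
Hypothesis room : (#|A true :|: A false| + #|D :\: spec| + C * Delta + z <= #|V|)%N.
Hypothesis deg : forall x, (theta < #|neighbors g x :\: (A true :|: A false)|)%N.

Let Aall := A true :|: A false.

Let placed (f : U -> V) v :=
  if v \in spec then f v \in O v (f (pred v)) else g (f (pred v)) (f v) && (f v \notin Aall).

Let kidcount (Dm : {set U}) (f : U -> V) x := #|[set v in Dm :\ r :\: spec | f (pred v) == x]|.

Let potential (Dm : {set U}) (f : U -> V) :=
  \sum_t om t * \prod_(v in spec :&: Dm) phi v (f (pred v)) (f v) t.

Let partial_embedding (Dm : {set U}) (f : U -> V) : Prop :=
  [/\ [/\ Dm \subset D, r \in Dm & forall v, v \in Dm -> v != r -> pred v \in Dm],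
      {in Dm &, injective f} /\ f r = x0,
      forall v, v \in Dm -> v != r -> placed f v,
      exists P S, reservation g Aall Delta C theta (f @: Dm) (kidcount Dm f) P S
    & potential Dm f <= \sum_t om t].

Lemma eq_reservation (A' B : {set V}) (k k' : V -> nat) P S : k =1 k' ->
  reservation g A' Delta C theta B k P S -> reservation g A' Delta C theta B k' P S.
Proof. by move=> kk' [? ? H ? ?]; split => // x /H; rewrite kk'. Qed.

Lemma partial_embedding_start : partial_embedding [set r] (fun=> x0).
Proof.
split.
- by rewrite sub1set set11; split => // v; rewrite inE => /eqP ->; rewrite eqxx.
- by split => // u v; rewrite !inE => /eqP -> /eqP ->.
- by move=> v; rewrite inE => /eqP ->; rewrite eqxx.
- exists set0, (fun=> set0); rewrite imset_set1.
  have : reservation g Aall Delta C theta [set x0] (fun=> 0%N) set0 (fun=> set0).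
    by apply: reservation0 => // x; rewrite cards1 addn1 deg.
  apply: eq_reservation.
  move=> x; rewrite /kidcount (_ : [set _ in _ | _] = set0) ?cards0 //.
  by apply/setP => v; rewrite !inE; case: eqP; rewrite ?andbF.
rewrite /potential (_ : spec :&: [set r] = set0); last first.
  by apply/setP => v; rewrite !inE; case: eqP => [->|]; rewrite ?andbF // (negbTE r_spec).
by apply: ler_sum => t _; rewrite big_set0 mulr1.
Qed.

Lemma partial_embedding_step Dm f : partial_embedding Dm f -> (#|Dm| < #|D|)%N ->
  exists v f', v \notin Dm /\ partial_embedding (v |: Dm) f'.
Proof.
move=> [[DmD rDm predDm] [finj fr] fpl [P [S resv]] pot] lt.
have [v1 v1P] : exists v, v \in D :\: Dm.
  apply/set0Pn; rewrite -card_gt0 cardsD (setIidPr DmD) subn_gt0 //.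
have [v vD vmin] : exists2 v, v \in D :\: Dm & forall u, u \in D :\: Dm -> (rk v <= rk u)%N.
  by case: (arg_minnP rk v1P) => v; exists v.
move: vD; rewrite inE => /andP[vDm vD].
have vr : v != r by apply: contraNneq vDm => ->.
have pDm : pred v \in Dm.
  have [pD rkp] := predP vD vr; apply: contraT => pDm.
  by have := vmin (pred v); rewrite inE pDm pD leqNgt rkp => /(_ isT).
pose upd y u := if u == v then y else f u.
have updv y : upd y v = y by rewrite /upd eqxx.
have updm y u : u \in Dm -> upd y u = f u.
  by rewrite /upd; case: eqP => // ->; rewrite (negbTE vDm).
have updim y : upd y @: (v |: Dm) = y |: f @: Dm.
  rewrite imsetU1 updv; congr (_ |: _); apply: eq_in_imset => u; exact: updm.
have specA u : u \in Dm -> u \in spec -> f u \in A (cls u).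
  move=> uDm us; have ur : u != r by apply: contraNneq r_spec => <-.
  by have := fpl u uDm ur; rewrite /placed us => /(subsetP (OA _ us)).
have Asub c : A c \subset Aall by case: c; rewrite /Aall ?subsetUl ?subsetUr.
have Ainj c c' x : x \in A c -> x \in A c' -> c = c'.
  by case: c c' => [] [] // h1 h2; [have := disjointFr disA h1|have := disjointFr disA h2];
    rewrite ?h2 ?h1.
have step y : y \notin f @: Dm -> placed (upd y) v ->
    (exists P S, reservation g Aall Delta C theta (y |: f @: Dm)
        (fun x => (kidcount Dm f x + ((v \notin spec) && (f (pred v) == x)))%N) P S) ->
    \sum_t om t * ((if v \in spec then phi v (f (pred v)) y t else 1) *
      \prod_(u in spec :&: Dm) phi u (f (pred u)) (f u) t) <= \sum_t om t ->
    exists v0 f', v0 \notin Dm /\ partial_embedding (v0 |: Dm) f'.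
  move=> yDm yv [P' [S' res']] pot'; exists v, (upd y); split => //; split.
  - split; first by rewrite subUset sub1set vD.
      by rewrite inE rDm orbT.
    move=> u; rewrite !inE => /orP[/eqP -> _|uDm ur]; first by rewrite pDm orbT.
    by rewrite predDm ?orbT.
  - split; last by rewrite updm.
    move=> u w; rewrite !inE => /orP[/eqP ->|uDm] /orP[/eqP ->|wDm] //.
    + by rewrite updv updm // => E; rewrite E imset_f in yDm.
    + by rewrite updv updm // => E; rewrite -E imset_f in yDm.
    by rewrite !updm //; apply: finj.
  - move=> u; rewrite !inE => /orP[/eqP -> //|uDm ur].
    by have := fpl u uDm ur; rewrite /placed !updm // predDm.
  - exists P', S'; rewrite updim; apply: eq_reservation res' => x.
    rewrite /kidcount (cardsD1 v [set _ in (v |: Dm) :\ r :\: spec | _]) addnC.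
    rewrite !inE vr eqxx /= andbT updm //; congr (_ + _)%N.
    apply: eq_card => u; rewrite !inE.
    have [->|uv] := eqVneq u v; first by rewrite (negbTE vDm) !andbF.
    rewrite /=; have [uDm|] := boolP (u \in Dm); last by rewrite !andbF.
    by have [->|ur] := eqVneq u r; rewrite /= ?andbF // updm // predDm.
  rewrite /potential; apply: le_trans pot'; rewrite le_eqVlt; apply/orP; left; apply/eqP.
  apply: eq_bigr => t _; congr (_ * _).
  have prodE : \prod_(u in spec :&: Dm) phi u (upd y (pred u)) (upd y u) t =
      \prod_(u in spec :&: Dm) phi u (f (pred u)) (f u) t.
    apply: eq_bigr => u; rewrite inE => /andP[us uDm].
    have ur : u != r by apply: contraNneq r_spec => <-.
    by rewrite !updm // predDm.
  rewrite -{}prodE; case: ifP => vs.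
    rewrite (_ : spec :&: (v |: Dm) = v |: (spec :&: Dm)); last first.
      by apply/setP => u; rewrite !inE; case: eqP => // ->; rewrite vs.
    by rewrite big_setU1 ?inE ?(negbTE vDm) ?andbF //= updv updm.
  rewrite mul1r; apply: eq_bigl => u; rewrite !inE; case: eqP => // ->.
  by rewrite vs.
have [vs|vs] := boolP (v \in spec).
  have [|ne av] := @avg v (f (pred v)) (f @: Dm) vs.
    (* The root may have been put inside [A (cls v)]. It is paid for by [v], which belongs to its
       class but is not embedded yet. *)
    have sub : f @: Dm :&: A (cls v) \subset x0 |: f @: ([set u in spec | cls u == cls v] :\ v).
      apply/subsetP => y; rewrite !inE => /andP[/imsetP[u uDm ->]] yA.
      have [->|ur] := eqVneq u r; first by rewrite fr eqxx.
      apply/orP; right; have := fpl u uDm ur; rewrite /placed; case: ifP => us; last first.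
        by move=> /andP[_ /negP]; case; apply: (subsetP (Asub _)) yA.
      move=> _; apply: imset_f; rewrite !inE us (Ainj _ _ _ (specA _ uDm us) yA) eqxx !andbT.
      by apply: contraNneq vDm => <-.
    apply: leq_trans (subset_leq_card sub) _; rewrite cardsU1.
    rewrite [leqRHS](cardsD1 v) inE vs eqxx /=; apply: leq_add; first by case: (_ \in _).
    exact: leq_imset_card.
  have [|y] := @averaging V Th _ (fun t => om t * \prod_(u in spec :&: Dm) phi u (f (pred u)) (f u) t)
     (fun y t => phi v (f (pred v)) y t) ne _ av.
    by move=> t; rewrite mulr_ge0 // prodr_ge0.
  rewrite inE => /andP[yDm yO] le.
  apply: (step y) => //.
  - by rewrite /placed vs updv updm.
  - exists P, S; apply: (@eq_reservation _ _ (kidcount Dm f)); first by move=> x; rewrite vs addn0.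
    by apply: reservation_in_A resv; apply: (subsetP (Asub (cls v))); apply: (subsetP (OA _ vs)) yO.
  rewrite vs; apply: le_trans pot; apply: le_trans le.
  by apply: ler_sum => t _; rewrite mulrCA mulrC.
have kc : (kidcount Dm f (f (pred v)) < Delta)%N.
  apply: leq_trans (kids (subsetP DmD _ pDm)).
  rewrite [leqRHS](cardsD1 v) !inE vr vs vD eqxx /= add1n ltnS; apply: subset_leq_card.
  apply/subsetP => u; rewrite !inE => /andP[/and3P[us ur uDm] /eqP E].
  rewrite us ur (subsetP DmD) //=; apply/andP; split; first by apply: contraNneq vDm => <-.
  by apply/eqP/finj => //; apply: predDm.
have [|y [P' [S' [gy yAB res']]]] := reservation_step C_gt0 g_dense theta_le theta_ge resv kc.
  apply: leq_trans room; rewrite -addnA -[leqRHS]addnA -addSn leq_add2r.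
  have sub : Aall :|: f @: Dm \subset Aall :|: f @: (Dm :\: spec).
    apply/subsetP => y; rewrite !inE => /orP[->//|/imsetP[u uDm ->]].
    have [us|us] := boolP (u \in spec); last by rewrite imset_f ?orbT // inE us.
    by have := subsetP (Asub (cls u)) _ (specA _ uDm us); rewrite !inE => ->.
  apply: leq_ltn_trans (subset_leq_card sub) _.
  apply: leq_ltn_trans (leq_card_setU _ _) _; rewrite ltn_add2l.
  apply: leq_ltn_trans (leq_imset_card _ _) _.
  rewrite [ltnRHS](cardsD1 v) !inE vs vD /= add1n ltnS; apply: subset_leq_card.
  apply/subsetP => u; rewrite !inE => /andP[us uDm]; rewrite us (subsetP DmD) // !andbT.
  by apply: contraNneq vDm => <-.
move: yAB; rewrite inE negb_or => /andP[yA yDm].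
apply: (step y) => //.
- by rewrite /placed (negbTE vs) updv updm // gy.
- by exists P', S'; apply: eq_reservation res' => x; rewrite vs eq_sym.
by rewrite (negbTE vs); apply: le_trans pot; apply: ler_sum => t _; rewrite mul1r.
Qed.

(** As all summands are nonnegative, the last clause bounds the product of each single test [t] by
    the total weight divided by [om t]. *)
Theorem tree_embedding : exists f : U -> V,
  [/\ {in D &, injective f}, f r = x0,
      forall v, v \in D -> v != r -> v \notin spec ->
        g (f (pred v)) (f v) /\ f v \notin A true :|: A false,
      forall v, v \in spec -> f v \in O v (f (pred v)) &
      \sum_t om t * \prod_(v in spec) phi v (f (pred v)) (f v) t <= \sum_t om t].
Proof.
suff : forall n, (n < #|D|)%N -> exists (Dm : {set U}) f, #|Dm| = n.+1 /\ partial_embedding Dm f.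
  move=> /(_ #|D|.-1); have D0 : (0 < #|D|)%N by apply/card_gt0P; exists r.
  rewrite prednK // leqnn => /(_ isT)[Dm [f [cDm [[DmD _ _] [finj fr] fpl _ pot]]]].
  have E : Dm = D by apply/eqP; rewrite eqEcard DmD cDm leqnn.
  subst Dm; exists f; split => //.
  - by move=> v vD vr vs; have := fpl v vD vr; rewrite /placed (negbTE vs) => /andP[].
  - move=> v vs; have vr : v != r by apply: contraNneq r_spec => <-.
    by have := fpl v (subsetP specD _ vs) vr; rewrite /placed vs.
  by move: pot; rewrite /potential (setIidPl specD).
elim=> [|n IH] lt; first by exists [set r], (fun=> x0);
  rewrite cards1; split => //; exact: partial_embedding_start.
have [Dm [f [cDm pe]]] := IH (ltnW lt).
have [|v [f' [vDm pe']]] := partial_embedding_step pe; first by rewrite cDm.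
by exists (v |: Dm), f'; rewrite cardsU1 vDm cDm.
Qed.
End TreeEmbedding.

(** * A vertex with large codegrees *)

Section Codegrees.
Variables (V : finType) (g : rel V) (A : {set V}) (C y1 L : nat).
Hypothesis g_dense : dense g C y1.
Hypothesis degA : forall x, #|A| <= 64 * #|A :&: neighbors g x|.
Hypothesis y1_le : 64 * y1 <= #|A|.
Hypothesis L_ge : 64 * 64 <= L.

Definition codegree x w := #|A :&: neighbors g x :&: neighbors g w|.

Definition good_pair x w := #|A| <= L * codegree x w.

Lemma codegreeC x w : codegree x w = codegree w x.
Proof. by rewrite /codegree setIAC. Qed.

Lemma good_pairC x w : good_pair x w = good_pair w x.
Proof. by rewrite /good_pair codegreeC. Qed.

(** Among any [C] vertices one sees a 1/64 fraction of [A :&: neighbors g w], which itself is at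
    least a 1/64 fraction of [A]. *)
Lemma few_bad_pairs w : #|[set x | ~~ good_pair x w]| < C.
Proof.
rewrite ltnNge; apply/negP => CB.
have [|x] := g_dense (Y := A :&: neighbors g w) CB.
  by have := degA w; move: y1_le; lia.
rewrite inE => bad le; case/negP: bad; rewrite /good_pair codegreeC /codegree.
apply: leq_trans (degA w) _; apply: leq_trans (leq_mul (leqnn 64) le) _.
by rewrite mulnA leq_mul.
Qed.

(** Greedy choice: a chosen pair of [x] and [w x] excludes these two vertices and their preimages
    under [w], hence at most [2 * c + 2] vertices. *)
Lemma pick_matching (w : V -> V) (X0 : {set V}) (c m : nat) :
  (forall u, #|[set x | w x == u]| <= c) -> m * (2 * c + 2) <= #|X0| ->
  exists X : {set V}, [/\ X \subset X0, #|X| = m, {in X &, injective w} &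
     {in X &, forall x x', x != x' -> w x != x'}].
Proof.
move=> fib; elim: m => [|m IH] le.
  by exists set0; rewrite sub0set cards0; split => // x; rewrite inE.
have [|X [XX0 cX winj wX]] := IH; first by apply: leq_trans le; rewrite leq_mul2r leqnSn orbT.
pose Q := \bigcup_(u in X :|: w @: X) [set x | w x == u].
have cQ : #|Q| <= (m + m) * c.
  apply: (@leq_trans (\sum_(u in X :|: w @: X) c)).
    apply: (@leq_trans (\sum_(u in X :|: w @: X) #|[set x | w x == u]|)); last by apply: leq_sum => u _.
    rewrite /Q; elim/big_rec2: _ => [|u k B' _ le']; first by rewrite cards0.
    by apply: leq_trans (leq_card_setU _ _) _; rewrite leq_add2l.
  rewrite sum_nat_const leq_mul2r -[in X in _ <= X]cX; apply/orP; right.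
  apply: leq_trans (leq_card_setU _ _) _; rewrite leq_add2l cX -cX; exact: leq_imset_card.
have [x xX0 xbad] : exists2 x, x \in X0 & x \notin X :|: w @: X :|: Q.
  apply/exists_inP; apply: contraT => /exists_inPn none.
  have : X0 \subset X :|: w @: X :|: Q by apply/subsetP => x /none; rewrite negbK.
  move/subset_leq_card; rewrite leqNgt; case/negP.
  apply: leq_ltn_trans (leq_card_setU _ _) _.
  apply: (@leq_ltn_trans (m + m + (m + m) * c)); last by apply: leq_trans le; nia.
  apply: leq_add cQ; apply: leq_trans (leq_card_setU _ _) _; rewrite cX leq_add2l -cX.
  exact: leq_imset_card.
move: xbad; rewrite !in_setU !negb_or => /andP[/andP[xX xwX] xQ].
have wxQ u : u \in X :|: w @: X -> w x != u.
  by move=> uX; apply: contra xQ => E; apply/bigcupP; exists u => //; rewrite inE.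
have wxX u : u \in X -> w x != u by move=> uX; apply: wxQ; rewrite inE uX.
have wxwX u : u \in X -> w x != w u by move=> uX; apply: wxQ; rewrite inE imset_f ?orbT.
exists (x |: X); split.
- by rewrite subUset sub1set xX0.
- by rewrite cardsU1 xX cX.
- move=> u v; rewrite !inE => /orP[/eqP ->|uX] /orP[/eqP ->|vX] //.
  + by move=> E; have := wxwX v vX; rewrite E eqxx.
  + by move=> E; have := wxwX u uX; rewrite E eqxx.
  exact: winj.
move=> u v; rewrite !inE => /orP[/eqP ->|uX] /orP[/eqP ->|vX]; rewrite ?eqxx // => uv.
- exact: wxX.
- by apply: contraNneq xwX => <-; apply: imset_f.
exact: wX.
Qed.

Lemma enum_injection (I : finType) (X : {set V}) : #|X| = #|I| ->
  exists f : {ffun I -> V}, injective f /\ forall i, f i \in X.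
Proof.
move=> cX; have lt (i : I) : enum_rank i < size (enum X) by rewrite -cardE cX.
have [I0|/card_gt0P[i0 _]] := posnP #|I|.
  have no (i : I) : False by have := fintype0 i; rewrite I0; apply.
  by exists [ffun i => False_rect V (no i)]; split => i; case: (no i).
have v0 : V by have := lt i0; case: (enum X) => // v *; exact: v.
exists [ffun i => nth v0 (enum X) (enum_rank i)]; split => [i j|i]; rewrite !ffunE.
  by move/eqP; rewrite nth_uniq ?enum_uniq // => /eqP/val_inj/enum_rank_inj.
by rewrite -mem_enum mem_nth.
Qed.

(* Otherwise every vertex has a bad partner.  As no vertex is a bad partner of
   more than [C] others, a linear number of these pairs are disjoint, and by
   [cherry] some of them have large codegree after all. *)
Lemma exists_good_vertex (h : nat) :
  (forall x w : {ffun bool * 'I_h -> V}, injective x -> injective w ->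
     (forall a b, x a != w b) ->
     h * h %/ 32 < #|[set p : 'I_h * 'I_h |
        g (x (true, p.1)) (x (false, p.2)) &&
        (g (w (false, p.2)) (x (true, p.1)) || g (w (true, p.1)) (x (false, p.2)))]|) ->
  symmetric g -> 2 * h * (2 * C + 2) <= #|A| -> 2 * h * #|A| <= L * (h * h %/ 32) ->
  0 < #|A| -> exists x, forall w, good_pair x w.
Proof.
move=> cherry gsym hA hL A0.
have [/existsP[x /forallP ?]|/existsPn none] := boolP [exists x, [forall w, good_pair x w]]; first by exists x.
have bad_partner x : exists w, ~~ good_pair x w by apply/existsP; rewrite -negb_forall none.
have [wf wfP] := fin_all_exists bad_partner.
have wfx x : wf x != x.
  apply: contraNneq (wfP x) => ->; rewrite /good_pair /codegree -setIA setIid.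
  apply: leq_trans (degA x) _; rewrite leq_mul2r; apply/orP; right; exact: leq_trans L_ge.
have fib u : #|[set x | wf x == u]| <= C.
  apply: leq_trans (ltnW (few_bad_pairs u)); apply: subset_leq_card; apply/subsetP => x.
  by rewrite !inE => /eqP <-.
have [X [XA cX winj wX]] := pick_matching fib hA.
have [|x [xi xX]] := @enum_injection (bool * 'I_h)%type X.
  by rewrite cX card_prod card_bool card_ord.
pose w := [ffun a => wf (x a)].
have wi : injective w by move=> a b; rewrite !ffunE => /winj => /(_ (xX a) (xX b)) /xi.
have xw a b : x a != w b.
  rewrite ffunE eq_sym; have [->|ab] := eqVneq a b; first exact: wfx.
  by apply: wX; rewrite ?xX // (inj_eq xi) eq_sym.
move: (cherry x w xi wi xw); set Ch := [set p | _] => lt.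
have codegL a : L * codegree (x a) (w a) <= #|A|.
  by have := wfP (x a); rewrite /good_pair -ltnNge ffunE => /ltnW.
(* Each counted pair of indices puts one of its two x-vertices into the common neighbourhood of the
   other one and its partner, and is charged to that codegree. *)
have ChU : #|Ch| <= \sum_i codegree (x (true, i)) (w (true, i)) + \sum_i codegree (x (false, i)) (w (false, i)).
  pose E1 i := [set j | x (false, j) \in A :&: neighbors g (x (true, i)) :&: neighbors g (w (true, i))].
  pose E2 j := [set i | x (true, i) \in A :&: neighbors g (x (false, j)) :&: neighbors g (w (false, j))].
  have sub : Ch \subset [set p | p.2 \in E1 p.1] :|: [set p | p.1 \in E2 p.2].
    apply/subsetP => -[i j]; rewrite !inE /= => /andP[gij].
    rewrite !(subsetP XA _ (xX _)) /= gij (gsym (x (false, j))) gij /=.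
    by case/orP => ->; rewrite ?orbT.
  apply: leq_trans (subset_leq_card sub) _; apply: leq_trans (leq_card_setU _ _) (leq_add _ _).
    rewrite -sum1dep_card -(pair_big_dep xpredT (fun i j => j \in E1 i) (fun _ _ => 1)) /=.
    apply: leq_sum => i _; rewrite sum1_card -(card_imset _ (f := fun j => x (false, j))); last first.
      by move=> j j' /xi[].
    by apply: subset_leq_card; apply/subsetP => v /imsetP[j]; rewrite inE => ? ->.
  rewrite -sum1dep_card (reindex_inj (h := fun p : 'I_h * 'I_h => (p.2, p.1))) /=; last first.
    by move=> [? ?] [? ?] [-> ->].
  rewrite -(pair_big_dep xpredT (fun j i => i \in E2 j) (fun _ _ => 1)) /=.
  apply: leq_sum => j _; rewrite sum1_card -(card_imset _ (f := fun i => x (true, i))); last first.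
    by move=> i i' /xi[].
  by apply: subset_leq_card; apply/subsetP => v /imsetP[i]; rewrite inE => ? ->.
have sumL b : L * \sum_i codegree (x (b, i)) (w (b, i)) <= h * #|A|.
  rewrite big_distrr /= -[h in leqRHS]card_ord -sum_nat_const; exact: leq_sum.
move: lt ChU hL (sumL true) (sumL false) L_ge.
move: (h * h %/ 32) #|Ch| (\sum_i _) (\sum_i _) => q c s1 s2 qc cs.
have : L * q.+1 <= L * (s2 + s1) by rewrite leq_mul2l (leq_trans qc cs) orbT.
by rewrite mulnS mulnDr -mulnA; lia.
Qed.
End Codegrees.

(** * Trees with many leaves *)

Section ExponentialAverages.
Local Open Scope ring_scope.
Variables (R : realType) (V : finType).

Lemma expRN_le (u : R) : 0 <= u -> u <= 1 -> expR (- u) <= 1 - u / 2%:R.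
Proof.
move=> u0 u1; rewrite expRN -[leRHS]mulr1 -[leLHS]mul1r ler_pdivrMr ?expR_gt0 // mulr1.
apply: (@le_trans _ _ ((1 - u / 2%:R) * (1 + u))); first by nra.
by rewrite ler_wpM2l ?expR_ge1Dx //; lra.
Qed.

(** The average of [expR (- (h * u))] is at most [1 - rho * u / 2], hence at most
    [expR (- (rho / 2 * u))]; the constant factor compensates exactly for this. *)
Lemma sum_expRN_le (S : {set V}) (h : pred V) (u rho : R) : 0 <= u -> u <= 1 -> 0 <= rho ->
  rho * #|S|%:R <= #|[set y in S | h y]|%:R ->
  \sum_(y in S) expR (rho / 2%:R * u) * expR (- ((h y)%:R * u)) <= #|S|%:R.
Proof.
move=> u0 u1 rho0 hS; rewrite -mulr_sumr.
have le1 : \sum_(y in S) expR (- ((h y)%:R * u)) <= #|S|%:R - u / 2%:R * #|[set y in S | h y]|%:R.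
  apply: (@le_trans _ _ (\sum_(y in S) (1 - u / 2%:R * (h y)%:R))).
    apply: ler_sum => y _; case: (h y); rewrite ?mul1r ?mulr1 ?mul0r ?mulr0 ?subr0; first exact: expRN_le.
    by rewrite oppr0 expR0.
  rewrite big_split /= sumr_const sumrN -mulr_sumr lerD2l lerN2 ler_wpM2l ?divr_ge0 //.
  rewrite -sum1dep_card natr_sum big_mkcondr /=.
  by apply: ler_sum => y _; case: (h y).
apply: le_trans (ler_wpM2l (expR_ge0 _) le1) _.
have le2 : #|S|%:R - u / 2%:R * #|[set y in S | h y]|%:R <= #|S|%:R * expR (- (rho / 2%:R * u)).
  apply: (@le_trans _ _ (#|S|%:R * (1 - rho / 2%:R * u))); last first.
    by rewrite ler_wpM2l // expR_ge1Dx.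
  have := ler_wpM2l (_ : 0 <= u / 2%:R) hS; rewrite divr_ge0 // => /(_ isT); lra.
apply: le_trans (ler_wpM2l (expR_ge0 _) le2) _.
by rewrite mulrCA expRN mulfV ?mulr1 // gt_eqF ?expR_gt0.
Qed.
End ExponentialAverages.

Definition leaves (U : finType) (e : rel U) : {set U} := [set v | #|neighbors e v| <= 1].

Section LeafCase.
Local Open Scope ring_scope.
Variables (R : realType) (U V : finType) (g : rel V) (e : rel U) (r : U) (par : U -> U) (dep : U -> nat).
Hypothesis cUV : #|U| = #|V|.
Hypothesis gsym : symmetric g.
Hypothesis e_sym : symmetric e.
Hypothesis tree : rooted_at e r par dep.
Variables (Delta : nat).
Hypothesis Delta_max : forall u, (#|neighbors e u| <= Delta)%N.
Local Notation lv := (leaves e).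
Hypothesis r_leaf : r \notin lv.

Lemma par_notin_leaves v : v != r -> par v \notin lv.
Proof.
case: tree => _ _ parP _ vr; have [ev dv] := parP v vr.
have [-> //|ur] := eqVneq (par v) r; have [eu du] := parP _ ur.
rewrite inE -ltnNge; apply: (@leq_trans #|[set v; par (par v)]|).
  by rewrite cards2; case: eqP => // E; rewrite -E in du; move: du dv; clear; lia.
apply: subset_leq_card; apply/subsetP => w; rewrite !inE => /orP[]/eqP -> //.
by rewrite e_sym.
Qed.

Lemma kids_le (S : {set U}) u : (#|[set v in S | (v != r) && (par v == u)]| <= Delta)%N.
Proof.
case: tree => _ _ parP _.
apply: leq_trans (Delta_max u); apply: subset_leq_card; apply/subsetP => v.
rewrite !inE => /and3P[_ vr /eqP <-]; rewrite e_sym; exact: (parP _ vr).1.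
Qed.

Definition leaf_weight p := #|[set l in lv | par l == p]|.

Lemma leaf_weight_le p : (leaf_weight p <= Delta)%N.
Proof.
apply: leq_trans (kids_le lv p); apply: subset_leq_card; apply/subsetP => l.
rewrite !inE => /andP[ll ->]; rewrite ll andbT.
by apply: contraNneq r_leaf => <-; rewrite inE.
Qed.

Variables (P1 : {set U}) (x0 : V) (A : {set V}) (C z theta L C2 d G : nat).
Hypothesis P1_sub : P1 \subset ~: lv :\ r.
Hypothesis C_gt0 : (0 < C)%N.
Hypothesis g_dense : dense g C z.
Hypothesis g_dense2 : dense g C2 d.
Hypothesis degA : forall x, (#|A| <= 64 * #|A :&: neighbors g x|)%N.
Hypothesis degF : forall x, (theta < #|neighbors g x :\: A|)%N.
Hypothesis L_gt0 : (0 < L)%N.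
Hypothesis d_gt0 : (0 < d)%N.
Hypothesis Delta_gt0 : (0 < Delta)%N.
Hypothesis theta_le : (64 * theta <= z)%N.
Hypothesis theta_ge : (C.+1 * Delta.+1 <= theta)%N.
Hypothesis room : (#|A| + C * Delta + z <= #|lv|)%N.
Hypothesis A_ge : (64 * (d + #|P1|.+1) <= #|A|)%N.
Hypothesis A_geL : (2 * L * #|P1| <= #|A|)%N.
Hypothesis d_ge : (Delta * C2 <= d)%N.
Hypothesis good_mass : forall (f : U -> V) w, {in ~: lv &, injective f} -> f r = x0 ->
  (G <= \sum_(p in P1 | good_pair g A L (f (par p)) w) leaf_weight p)%N.
Hypothesis G_ge : d%:R + Delta%:R * ln (#|V|%:R : R) <= G%:R / (4 * L)%:R.

Let rho : R := (2 * L)%:R^-1.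
Let u p : R := (leaf_weight p)%:R / Delta%:R.
(** For a good pair the common neighbours fill a fraction [1 / L] of [A], and the places in use
    leave at least half of that, which is [rho]. The first factor charges the decrease thus
    guaranteed; for other pairs nothing is charged. *)
Let phi p x y w : R := expR (rho / 2%:R * ((good_pair g A L x w)%:R * u p)) * expR (- ((g y w)%:R * u p)).

Let u01 p : 0 <= u p <= 1.
Proof.
by rewrite divr_ge0 //= ler_pdivrMr ?ltr0n // mul1r ler_nat leaf_weight_le.
Qed.

Let option_avg p x (B : {set V}) : p \in P1 -> (#|B :&: A| <= #|P1|)%N ->
  (0 < #|(A :&: neighbors g x) :\: B|)%N /\
  forall w, \sum_(y in (A :&: neighbors g x) :\: B) phi p x y w <= #|(A :&: neighbors g x) :\: B|%:R.
Proof.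
move=> pP cB; set S := A :&: neighbors g x.
have cBS (S' : {set V}) : S' \subset A -> (#|S'| <= #|S' :\: B| + #|P1|)%N.
  move=> S'A; rewrite -(cardsID B S') addnC leq_add2l; apply: leq_trans cB.
  by apply: subset_leq_card; rewrite setIC setIS.
have SA : S \subset A by apply: subsetIl.
split; first by have := cBS _ SA; have := degA x; move: A_ge; rewrite -/S; lia.
move=> w; have /andP[u0 u1] := u01 p; rewrite /phi.
case gd: (good_pair g A L x w); last first.
  under eq_bigr => y _ do rewrite mul0r mulr0 expR0 mul1r.
  have H0 : 0 * #|S :\: B|%:R <= #|[set y in S :\: B | g y w]|%:R :> R by rewrite mul0r.
  apply: le_trans (sum_expRN_le u0 u1 (lexx 0) H0).
  by apply: ler_sum => y _; rewrite !mul0r expR0 mul1r.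
under eq_bigr => y _ do rewrite mul1r.
apply: (@sum_expRN_le R V (S :\: B) (fun y => g y w)) => //; first by rewrite invr_ge0.
rewrite /rho ler_pdivrMl ?ltr0n ?muln_gt0 // -natrM ler_nat.
have -> : [set y in S :\: B | g y w] = (S :&: neighbors g w) :\: B.
  by apply/setP => y; rewrite !inE (gsym w); case: (y \in B); rewrite ?andbF.
apply: (@leq_trans #|A|); first by apply: subset_leq_card; apply: subset_trans (subsetDl _ _) SA.
have := cBS (S :&: neighbors g w) (subset_trans (subsetIl _ _) SA).
move: gd; rewrite /good_pair /codegree -/S; move: A_geL.
move: #|A| #|S :&: _| #|_ :\: B| => a b c H1 H2 H3.
have : (2 * L * b <= 2 * L * (c + #|P1|))%N by rewrite leq_mul2l H3 orbT.
by lia.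
Qed.

(** The slots are the leaves, and the vertices of [P1] go to [A] so that their leaves become
    available to every [w]. The bound [good_mass] is required of all injections because the
    positions of the parents are only determined during the embedding. *)
Theorem leaf_case : contains_copy g e.
Proof.
have [par_r _ parP edgeP] := tree.
have rP1 : r \notin P1 by apply/negP => /(subsetP P1_sub); rewrite !inE eqxx.
have P1D : P1 \subset ~: lv by apply: subset_trans P1_sub (subsetDl _ _).
have lvr l : l \in lv -> l != r by apply: contraTneq => ->.
have [||||||||||f [finj fr ford fspec fpot]] := @tree_embedding R U V V g (~: lv) r par dep P1
  (fun _ x => A :&: neighbors g x) xpredT (fun b => if b then A else set0) phi (fun=> 1) x0
  Delta C theta z _ rP1 P1D _ _ _ _ _ _ _ C_gt0 g_dense theta_le theta_ge _ _.
- by rewrite inE.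
- move=> v vD vr; split; first by rewrite inE par_notin_leaves.
  by rewrite (parP _ vr).2.
- move=> w wD; apply: leq_trans (kids_le (~: lv) w); apply: subset_leq_card.
  by apply/subsetP => v; rewrite !inE => /andP[/and3P[_ -> ->] ->].
- by rewrite -setI_eq0 setI0.
- by move=> v x _; apply: subsetIl.
- by move=> p x y w; rewrite mulr_ge0 ?expR_ge0.
- by [].
- move=> v x B vP; rewrite (_ : [set w in P1 | true == true] = P1); first exact: option_avg.
  by apply/setP => w; rewrite inE eqxx andbT.
- rewrite setU0; have := cardsC lv; rewrite -cUV.
  have : (#|~: lv :\: P1| <= #|~: lv|)%N by apply: subset_leq_card; apply: subsetDl.
  by move: room; lia.
- by move=> x; rewrite setU0.
rewrite setU0 in ford.
have usedA : (#|A :&: (f @: ~: lv)| <= #|P1|.+1)%N.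
  have sub : A :&: (f @: ~: lv) \subset f @: (r |: P1).
    apply/subsetP => y; rewrite inE => /andP[yA /imsetP[v vD E]]; rewrite E in yA *.
    apply: imset_f; rewrite !inE; case: eqP => //= /eqP vr.
    by apply: contraT => vP; have := (ford v vD vr vP).2; rewrite yA.
  apply: leq_trans (subset_leq_card sub) _; apply: leq_trans (leq_imset_card _ _) _.
  by rewrite cardsU1 rP1.
(* Taking logarithms in the potential of [w] shows that at least [G / (4 * L) - Delta * ln n] leaves
   suit [w]; here [4 * L] is [2 / rho], and [Delta] comes from the normalisation of [u]. *)
have gain w : (d <= #|[set l in lv | g (f (par l)) w]|)%N.
  have potw : \prod_(p in P1) phi p (f (par p)) (f p) w <= #|V|%:R.
    apply: le_trans (_ : \sum_(t : V) 1 * \prod_(p in P1) phi p (f (par p)) (f p) t <= _).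
      rewrite (bigD1 w) //= mul1r lerDl; apply: sumr_ge0 => t _.
      by rewrite mul1r prodr_ge0 // => p _; rewrite mulr_ge0 ?expR_ge0.
    by apply: le_trans fpot _; rewrite sumr_const.
  pose gained := (\sum_(p in P1 | g (f p) w) leaf_weight p)%N.
  have le_gained : (gained <= #|[set l in lv | g (f (par l)) w]|)%N.
    rewrite /gained -sum1dep_card.
    rewrite [leqRHS](partition_big par xpredT) //= [leqLHS]big_mkcond /=.
    apply: leq_sum => p _; case: ifP => // /andP[pP gp]; rewrite /leaf_weight -sum1dep_card.
    rewrite [leqLHS]big_mkcond [leqRHS]big_mkcond /=; apply: leq_sum => l _.
    by case: (l \in lv) => //=; case: eqP => [->|]; rewrite ?gp ?andbF.
  apply: leq_trans le_gained; rewrite -(ler_nat R).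
  have V0 : 0 < (#|V|%:R : R) by rewrite ltr0n; apply/card_gt0P; exists w.
  have expo : \sum_(p in P1) (rho / 2%:R * ((good_pair g A L (f (par p)) w)%:R * u p) - (g (f p) w)%:R * u p)
      <= ln (#|V|%:R : R).
    rewrite -ler_expR lnK ?posrE // expR_sum; apply: le_trans potw.
    by rewrite le_eqVlt; apply/orP; left; apply/eqP; apply: eq_bigr => p _; rewrite expRD.
  have sumE (h : U -> bool) : \sum_(p in P1) (h p)%:R * u p = (\sum_(p in P1 | h p) leaf_weight p)%:R / Delta%:R.
    rewrite natr_sum mulr_suml [RHS]big_mkcondr /=.
    by apply: eq_bigr => p _; case: (h p); rewrite ?mul1r ?mul0r.
  rewrite big_split /= sumrN -mulr_sumr !sumE -/gained in expo.
  have D0 : 0 < (Delta%:R : R) by rewrite ltr0n.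
  have := good_mass w finj fr; set Gw := (\sum_(p in P1 | _) _)%N in expo * => GGw.
  have GGw' : (G%:R : R) <= Gw%:R by rewrite ler_nat.
  have expo2 : rho / 2%:R * Gw%:R - gained%:R <= Delta%:R * ln (#|V|%:R : R).
    rewrite -ler_pdivrMl //; apply: le_trans expo.
    by rewrite mulrC mulrBl mulrA.
  have rhoE : rho / 2%:R = (4 * L)%:R^-1.
    rewrite /rho -invfM -natrM; congr (_%:R^-1); lia.
  have : G%:R / (4 * L)%:R <= rho / 2%:R * Gw%:R.
    by rewrite rhoE mulrC ler_wpM2l // invr_ge0.
  by move: G_ge; lra.
have [i iD|w wD|S W SD WD cS cW|F [Finj FD Fok]] :=
   @complete_matching U V (~: lv) f (fun l w => g (f (par l)) w) d cUV finj.
- rewrite inE negbK in iD; set x := f (par i).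
  apply: (@leq_trans #|(A :&: neighbors g x) :\: (f @: ~: lv)|).
    have := degA x; rewrite -(cardsID (f @: ~: lv) (A :&: neighbors g x)).
    have : (#|A :&: neighbors g x :&: (f @: ~: lv)| <= #|P1|.+1)%N.
      by apply: leq_trans usedA; apply: subset_leq_card; rewrite setIAC; apply: subsetIl.
    by move: A_ge; lia.
  by apply: subset_leq_card; apply/subsetP => y; rewrite !inE => /and3P[-> _ ->].
- by rewrite setCK; apply: gain.
(* At most [Delta] leaves share a parent, so [d] leaves have enough distinct parents for density. *)
- have cX : (C2 <= #|[set f (par l) | l in S]|)%N.
    rewrite -(leq_pmul2l Delta_gt0); apply: (leq_trans d_ge); apply: (leq_trans cS).
    rewrite -sum1_card (partition_big (fun l => f (par l)) (mem [set f (par l) | l in S])) /=; last first.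
      by move=> l lS; apply: imset_f.
    rewrite mulnC -sum_nat_const; apply: leq_sum => x /imsetP[l lS ->].
    rewrite sum1_card; apply: leq_trans (kids_le S (par l)); apply: subset_leq_card.
    apply/subsetP => l'; rewrite !inE => /andP[l'S /eqP E].
    have nr i : i \in S -> i != r.
      by move=> /(subsetP SD); rewrite setCK => /lvr.
    by rewrite l'S nr //=; apply/eqP; apply: finj; rewrite ?in_setC ?par_notin_leaves ?nr.
  have [x /imsetP[l lS ->] le] := g_dense2 cX cW.
  have /card_gt0P[w] : (0 < #|W :&: neighbors g (f (par l))|)%N by lia.
  by rewrite !inE => /andP[wW gw]; exists l, w.
exists F => // x y exy.
have gpar v : v != r -> g (F (par v)) (F v).
  move=> vr; have pD : par v \in ~: lv by rewrite inE par_notin_leaves.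
  rewrite (FD _ pD); have [vD|vD] := boolP (v \in ~: lv); last exact: Fok.
  rewrite FD //; have [vP|vP] := boolP (v \in P1); last exact: (ford v vD vr vP).1.
  by have := fspec v vP; rewrite !inE => /andP[].
by case: (edgeP _ _ exy) => -[vr ->]; rewrite ?gpar // gsym gpar.
Qed.
End LeafCase.

(** * Trees with few leaves *)

Section PathCase.
Local Open Scope ring_scope.
Variables (R : realType) (U V : finType) (g : rel V) (e : rel U) (r : U) (par : U -> U) (dep : U -> nat).
Hypothesis cUV : #|U| = #|V|.
Hypothesis gsym : symmetric g.
Hypothesis e_sym : symmetric e.
Hypothesis tree : rooted_at e r par dep.
Variables (Delta : nat).
Hypothesis Delta_max : forall u, (#|neighbors e u| <= Delta)%N.

Definition only_child_parents : {set U} :=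
  [set v | (#|[set w | (w != r) && (par w == v)]| <= 1)%N].

Lemma only_child v w w' : v \in only_child_parents -> w != r -> w' != r ->
  par w = v -> par w' = v -> w = w'.
Proof.
rewrite inE => /card_le1_eqP H wr w'r pw pw'.
by apply/esym; apply: H; rewrite inE ?wr ?w'r ?pw ?pw' eqxx.
Qed.

(* For [b] in [B] the vertices [par b] and [par (par (par b))] are slots, so that
   [b] and [par (par b)] become roots of components and may be placed freely.
   Those with [b] in [Bc] go to [A true] and control how many slots suit a given
   vertex; the residue of the depths keeps different slots apart. *)
Variables (B Bc : {set U}) (res : nat) (x0 : V) (A : bool -> {set V}) (C y1 z theta L C2 y2 d K k : nat).
Local Notation par2 b := (par (par b)).
Local Notation par3 b := (par (par (par b))).
Hypothesis B_bottom : forall b, b \in B -> [/\ (4 <= dep b)%N, (dep b = res %[mod 4])%N &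
  [/\ par b \in only_child_parents, par2 b \in only_child_parents & par3 b \in only_child_parents]].
Hypothesis BcB : Bc \subset B.
Hypothesis C_gt0 : (0 < C)%N.
Hypothesis g_dense : dense g C z.
Hypothesis g_dense1 : dense g C y1.
Hypothesis g_dense2 : dense g C2 y2.
Hypothesis disA : [disjoint A true & A false].
Hypothesis degA : forall x, (#|A true| <= 64 * #|A true :&: neighbors g x|)%N.
Hypothesis degF : forall x, (theta < #|neighbors g x :\: (A true :|: A false)|)%N.
Hypothesis y1_le : (64 * y1 <= #|A true|)%N.
Hypothesis y2_gt0 : (0 < y2)%N.
Hypothesis y2_le : (64 * y2 <= d)%N.
Hypothesis L_ge : (64 * 64 <= L)%N.
Hypothesis theta_le : (64 * theta <= z)%N.
Hypothesis theta_ge : (C.+1 * Delta.+1 <= theta)%N.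
Hypothesis room : (#|A true :|: A false| + C * Delta + z <= 4 * #|B|)%N.
Hypothesis A2_ge : (#|A true| + 2 * #|B| <= #|A false|)%N.
Hypothesis A1_ge : (128 * (C + 2 * #|Bc|) <= #|A true|)%N.
Hypothesis A1_geL : (L * (d + (2 * #|Bc|).+1) <= #|A true|)%N.
Hypothesis A1_geK : (K * C2 + C + 2 * #|Bc| < #|A true|)%N.
Hypothesis K_ge : (2 ^ k <= K)%N.
Hypothesis k_gt0 : (0 < k)%N.
Hypothesis k_ge : (6 * #|V| <= k * d)%N.
Hypothesis d_gt : (2 * (Delta * C2) < d)%N.
Hypothesis Bc_ge : d%:R + ln (#|V|.+1%:R : R) <= #|Bc|%:R / (256 * 256)%:R.

Let I : {set U} := (par @: B) :|: [set par3 b | b in B].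
Let spec : {set U} := [set v | (v != r) && (par v \in I)].
Let D : {set U} := ~: I.
Let pred v := if par v \in I then par2 v else par v.
Let cls v := (v \in Bc) || (v \in [set par2 b | b in Bc]).
(** The slot between [v] and [pred v] must receive a common neighbour of their images; a good pair
    has linearly many of these in [A true]. *)
Let O v x : {set V} := [set y in A (cls v) | good_pair g (A true) L x y].
Let kappa : R := 256%:R^-1.
Let exc (W : {set V}) x := ~~ (#|W| <= 64 * #|W :&: neighbors g x|)%N.
Let nocommon (W : {set V}) x y := [disjoint W :&: neighbors g x & neighbors g y].
Let blocked (W : {set V}) x y := [&& (d <= #|W|)%N, ~~ exc W x & nocommon W x y].

(** A test [w] wants both ends of a slot [par b] adjacent to [w]. The earlier end [par2 b] earns
    only the credit [kappa] for adjacency, and the factor of [b] consumes this credit. A test [W]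
    starts from 1/2, which leaves room for the rare factor [K]. *)
Let phi v x y (t : V + {set V}) : R :=
  match t with
  | inl w => if v \in [set par2 b | b in Bc] then
               expR (128%:R^-1 / 2%:R * kappa) * expR (- ((g y w)%:R * kappa))
             else if v \in Bc then
               expR (128%:R^-1 / 2%:R * (g x w)%:R) * expR (- ((g y w)%:R * (g x w)%:R))
             else 1
  | inr W => (if blocked W x y then K%:R else 1) / 2%:R
  end.

(** All the tests [W] together have weight 1, so the total is only [n + 1]. *)
Let om (t : V + {set V}) : R := if t is inl _ then 1 else 2%:R ^- #|V|.

Let depB b : b \in B -> [/\ b != r, par b != r, par2 b != r & par3 b != r].
Proof.
move=> /B_bottom[d4 _ _]; have [par_r dr parP _] := tree.
have ne x : (0 < dep x)%N -> x != r by apply: contraTneq => ->; rewrite dr.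
have br := ne b (leq_trans _ d4); rewrite br //; have := (parP b (br isT)).2 => db.
have pr : par b != r by apply: ne; lia.
have := (parP _ pr).2 => dpb; have p2r : par2 b != r by apply: ne; lia.
have := (parP _ p2r).2 => dp2b; have p3r : par3 b != r by apply: ne; lia.
by [].
Qed.

Let depBs b : b \in B -> [/\ dep b = (dep (par b)).+1, dep (par b) = (dep (par2 b)).+1,
  dep (par2 b) = (dep (par3 b)).+1 & dep (par3 b) = (dep (par (par3 b))).+1].
Proof.
by move=> /depB[? ? ? ?]; have [_ _ parP _] := tree; split; apply: (parP _ _).2.
Qed.

Let specE v : (v \in spec) = (v != r) && (par v \in I).
Proof. by rewrite in_set. Qed.

Let DE v : (v \in D) = (v \notin I).
Proof. by rewrite in_setC. Qed.

(** All slots have depths of one parity, so no slot is the parent of another one. *)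
Let depI v : v \in I -> odd (dep v) = ~~ odd res.
Proof.
have od n : (n = res %[mod 4])%N -> odd n = odd res by lia.
rewrite inE => /orP[] /imsetP[b bB ->]; have [d0 d1 d2 d3] := depBs bB;
  have [_ /od E _] := B_bottom bB; rewrite -E d0 ?d1 ?d2 /= ?negbK //.
Qed.

Let I_onechild v : v \in I -> v \in only_child_parents.
Proof. by rewrite inE => /orP[]/imsetP[b /B_bottom[_ _ [? ? ?]] ->]. Qed.

Let r_I : r \notin I.
Proof.
rewrite inE negb_or; apply/andP; split; apply/imsetP => -[b /depB[? pr ? p3r]] E.
  by rewrite -E eqxx in pr.
by rewrite -E eqxx in p3r.
Qed.

Let Ir v : v \in I -> v != r.
Proof. by apply: contraTneq => ->. Qed.

Let spec_I v : v \in spec -> v \in D.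
Proof.
have [_ _ parP _] := tree.
rewrite specE DE => /andP[vr pI]; apply/negP => vI.
by have := depI vI; rewrite (parP _ vr).2 /= (depI pI); case: (odd res).
Qed.

Let parI_D v : v != r -> par v \in I -> par2 v \in D.
Proof.
have [_ _ parP _] := tree => vr pI; rewrite DE; apply/negP => p2I.
by have := depI pI; rewrite (parP _ (Ir pI)).2 /= (depI p2I); case: (odd res).
Qed.

Let spec_par_inj : {in spec &, injective par}.
Proof.
move=> v w; rewrite !specE => /andP[vr pI] /andP[wr _] E.
by apply: (only_child (I_onechild pI)).
Qed.

Let bottom_spec b : b \in B -> b \in spec /\ par2 b \in spec.
Proof.
move=> bB; have [br _ p2r _] := depB bB.
by rewrite !specE br p2r !in_setU imset_f //= (imset_f (fun b => par3 b)) ?orbT.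
Qed.

Let par_inj_B : {in B &, injective par}.
Proof. by move=> b b' bB b'B; apply: spec_par_inj; exact: (bottom_spec _).1. Qed.

Let par2_inj_B : {in B &, injective (fun b => par2 b)}.
Proof.
move=> b b' bB b'B E; have [_ pr _ _] := depB bB; have [_ p'r _ _] := depB b'B.
have [_ _ [_ one _]] := B_bottom bB.
by apply: par_inj_B => //; apply: (only_child one).
Qed.

Let slot_spec i : i \in I -> exists2 v, v \in spec & par v = i.
Proof.
rewrite inE => /orP[]/imsetP[b bB ->]; have [b1 b2] := bottom_spec bB; first by exists b.
by exists (par2 b).
Qed.

Let card_spec : #|spec| = (2 * #|B|)%N.
Proof.
have -> : spec = B :|: [set par2 b | b in B].
  apply/setP => v; apply/idP/idP; last first.
    by rewrite inE => /orP[|/imsetP[b bB ->]]; [case/bottom_spec|case: (bottom_spec bB)].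
  move=> vs; have : par v \in I by move: vs; rewrite specE => /andP[].
  rewrite inE => /orP[]/imsetP[b bB E]; have [b1 b2] := bottom_spec bB.
    by rewrite (spec_par_inj vs b1 E) inE bB.
  by rewrite (spec_par_inj vs b2 E) inE (imset_f (fun b => par2 b)) ?orbT.
rewrite cardsU (card_in_imset par2_inj_B) (_ : B :&: _ = set0) ?cards0; first by lia.
apply/setP => v; rewrite !inE; apply/negP => /andP[vB /imsetP[b bB E]].
have [_ r1 _] := B_bottom vB; have [_ r2 _] := B_bottom bB; have [d0 d1 _ _] := depBs bB.
by move: r1 r2; rewrite E d0 d1; clear; lia.
Qed.

Let card_I : #|I| = (2 * #|B|)%N.
Proof.
rewrite -card_spec -(card_in_imset spec_par_inj); apply: eq_card => i; apply/idP/imsetP.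
  by move=> /slot_spec[v vs <-]; exists v.
by move=> [v + ->]; rewrite specE => /andP[].
Qed.

Let card_ctrl : (#|[set u in spec | cls u]| <= 2 * #|Bc|)%N.
Proof.
apply: (@leq_trans #|Bc :|: [set par2 b | b in Bc]|).
  by apply: subset_leq_card; apply/subsetP => v; rewrite !inE => /andP[].
apply: leq_trans (leq_card_setU _ _) _; rewrite mul2n -addnn leq_add2l; exact: leq_imset_card.
Qed.

Let few_bad x : (#|[set y | ~~ good_pair g (A true) L x y]| < C)%N.
Proof.
have := few_bad_pairs g_dense1 degA y1_le L_ge x; apply: leq_ltn_trans.
by apply: subset_leq_card; apply/subsetP => y; rewrite !inE good_pairC.
Qed.

Let few_exc (W : {set V}) : (d <= #|W|)%N -> (#|[set x | exc W x]| < C2)%N.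
Proof.
move=> dW; rewrite ltnNge; apply/negP => CX.
have [|x] := g_dense2 (Y := W) CX; first by move: y2_le; lia.
by rewrite inE /exc => /negP.
Qed.

(** Since [x] is not exceptional, [W :&: neighbors g x] is large enough for density. *)
Let few_blocked (W : {set V}) x : (#|[set y | blocked W x y]| < C2)%N.
Proof.
have C20 : (0 < C2)%N.
  rewrite lt0n; apply/eqP => C20; have := g_dense2 (X := set0) (Y := setT).
  rewrite C20 cards0 cardsT => /(_ isT); case; last by move=> y; rewrite inE.
  have : (#|A true| <= #|V|)%N by apply: max_card.
  by move: A1_geL L_ge y2_le; nia.
rewrite ltnNge; apply/negP => CX.
have [y] : exists y, y \in [set y | blocked W x y] by apply/card_gt0P; apply: leq_trans CX.
rewrite inE => /and3P[dW /negPn nex _].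
have [|y' ] := g_dense2 (Y := W :&: neighbors g x) CX; first by move: y2_le; lia.
rewrite inE => /and3P[_ _ dis].
move: dis; rewrite /nocommon -setI_eq0 => /eqP ->; rewrite cards0 muln0.
by move: y2_le y2_gt0; lia.
Qed.

Let option_card v x (Q : {set V}) : v \in spec ->
  (#|Q :&: A (cls v)| <= #|[set u in spec | cls u == cls v]|)%N ->
  (K * C2 < #|O v x :\: Q|)%N.
Proof.
move=> vs cQ.
have : (#|A (cls v)| <= #|O v x :\: Q| + #|Q :&: A (cls v)| + #|[set y | ~~ good_pair g (A true) L x y]|)%N.
  have sub : A (cls v) \subset (O v x :\: Q) :|: (Q :&: A (cls v)) :|: [set y | ~~ good_pair g (A true) L x y].
    by apply/subsetP => y yA; rewrite !inE yA; case: (y \in Q); case: (good_pair _ _ _ _ _).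
  apply: leq_trans (subset_leq_card sub) _; apply: leq_trans (leq_card_setU _ _) _.
  by rewrite leq_add2r; apply: leq_card_setU.
have := few_bad x; move: cQ A1_geK A2_ge.
case E : (cls v) => cQ.
  have : (#|[set u in spec | cls u == true]| <= 2 * #|Bc|)%N.
    by apply: leq_trans card_ctrl; apply: subset_leq_card; apply/subsetP => u; rewrite !inE eqb_id.
  by lia.
have : (#|[set u in spec | cls u == false]| <= 2 * #|B|)%N.
  by rewrite -card_spec; apply: subset_leq_card; apply/subsetP => u; rewrite inE => /andP[].
by lia.
Qed.

Let option_avg v x (Q : {set V}) : v \in spec ->
  (#|Q :&: A (cls v)| <= #|[set u in spec | cls u == cls v]|)%N ->
  (0 < #|O v x :\: Q|)%N /\
  forall t, \sum_(y in O v x :\: Q) phi v x y t <= #|O v x :\: Q|%:R.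
Proof.
move=> vs cQ; have cS := option_card x vs cQ; split; first exact: leq_ltn_trans cS.
have half w : cls v -> 128%:R^-1 * #|O v x :\: Q|%:R <= #|[set y in O v x :\: Q | g y w]|%:R :> R.
  move=> cv; rewrite ler_pdivrMl ?ltr0n // -natrM ler_nat.
  have sub : A true :&: neighbors g w \subset
      [set y in O v x :\: Q | g y w] :|: (Q :&: A true) :|: [set y | ~~ good_pair g (A true) L x y].
    apply/subsetP => y; rewrite !inE cv (gsym w) => /andP[-> ->].
    by case: (y \in Q); case: (good_pair _ _ _ _ _).
  have cO : (#|O v x :\: Q| <= #|A true|)%N.
    by apply: subset_leq_card; apply/subsetP => y; rewrite !inE cv => /and3P[].
  have cQ' : (#|Q :&: A true| <= 2 * #|Bc|)%N.
    move: cQ; rewrite cv => cQ; apply: leq_trans cQ _; apply: leq_trans card_ctrl.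
    by apply: subset_leq_card; apply/subsetP => u; rewrite !inE eqb_id.
  have := leq_trans (subset_leq_card sub) (leq_card_setU _ _).
  have := leq_of_leqif (leq_card_setU [set y in O v x :\: Q | g y w] (Q :&: A true)).
  by have := few_bad x; have := degA w; move: A1_ge; lia.
case=> [w|W] /=.
  case v1: (v \in [set par2 b | b in Bc]).
    apply: (@sum_expRN_le R V _ (fun y => g y w)); rewrite ?invr_ge0 ?invf_le1 ?ltr0n ?ler1n //.
    by apply: half; rewrite /cls v1 orbT.
  case v2: (v \in Bc); last by rewrite sumr_const.
  apply: (@sum_expRN_le R V _ (fun y => g y w)); rewrite ?invr_ge0 ?ler0n ?lern1 ?leq_b1 //.
  by apply: half; rewrite /cls v2.
(* Fewer than [C2] places are blocked and [K * C2] is below the number of places, so the average is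
   at most [(1 + 1) / 2]. *)
rewrite -mulr_suml ler_pdivrMr ?ltr0n // -natrM.
apply: (@le_trans _ _ (\sum_(y in O v x :\: Q) (1 + (K * blocked W x y)%:R))).
  apply: ler_sum => y _; case: (blocked W x y); rewrite ?muln1 ?muln0 ?addr0 //.
  by rewrite lerDr.
rewrite big_split /= sumr_const -natr_sum -natrD ler_nat muln2 -addnn leq_add2l.
apply: leq_trans (ltnW cS); rewrite -big_distrr /= leq_mul2l; apply/orP; right.
apply: leq_trans (ltnW (few_blocked W x)); rewrite -sum1dep_card [leqRHS]big_mkcond /= [leqLHS]big_mkcond /=.
by apply: leq_sum => y _; case: (blocked W x y); case: (_ \in _).
Qed.

Theorem path_case : contains_copy g e.
Proof.
have [par_r dep_r parP edgeP] := tree.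
have predP v : v \in D -> v != r -> pred v \in D /\ (dep (pred v) < dep v)%N.
  move=> vD vr; rewrite /pred; case: ifP => [pI|/negbT pI].
    by split; [exact: parI_D|rewrite (parP _ vr).2 (parP _ (Ir pI)).2; lia].
  by rewrite DE pI (parP _ vr).2.
have r_spec : r \notin spec by rewrite specE eqxx.
have specD : spec \subset D by apply/subsetP => v; exact: spec_I.
have pred_spec v : v \in spec -> pred v = par2 v.
  by rewrite specE /pred => /andP[_ ->].
have [||||||f [finj fr ford fspec fpot]] := @tree_embedding R U V _ g D r pred dep spec
  O cls A phi om x0 Delta C theta z _ r_spec specD predP _ disA _ _ _ option_avg C_gt0 g_dense
  theta_le theta_ge _ degF.
- by rewrite DE r_I.
- move=> w wD; apply: leq_trans (kids_le e_sym tree Delta_max setT w); apply: subset_leq_card.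
  apply/subsetP => v; rewrite in_set !in_setD in_set1 specE => /andP[/and3P[vs vr _] /eqP <-].
  by move: vs; rewrite in_set in_setT vr /pred /= => /negbTE ->; rewrite eqxx.
- by move=> v x _; apply/subsetP => y; rewrite inE => /andP[].
- move=> v x y [w|W] /=; last by case: ifP; rewrite divr_ge0.
  by case: ifP => _; [|case: ifP => _]; rewrite ?mulr_ge0 ?expR_ge0.
- by case=> [w|W] /=; rewrite ?invr_ge0 ?exprn_ge0.
- have : (#|D :\: spec| + #|spec| + #|I| = #|V|)%N.
    rewrite -cUV -(cardsC I) -(cardsID spec D) (setIidPr specD) /D; lia.
  by rewrite card_I card_spec; move: room; lia.
have total : \sum_t om t = #|V|%:R + 1.
  rewrite big_sumType /= !sumr_const; congr (_ + _).
  by rewrite card_sets -[LHS]mulr_natl natrX mulfV // expf_neq0 // pnatr_eq0.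
have phi_ge0 v x y t : 0 <= phi v x y t.
  case: t => [w|W] /=; last by case: ifP; rewrite divr_ge0.
  by case: ifP => _; [|case: ifP => _]; rewrite ?mulr_ge0 ?expR_ge0.
have pot t : om t * \prod_(v in spec) phi v (f (pred v)) (f v) t <= #|V|.+1%:R.
  rewrite -addn1 natrD -total; apply: le_trans fpot.
  rewrite [leRHS](bigD1 t) //= lerDl; apply: sumr_ge0 => t' _.
  by rewrite mulr_ge0 ?prodr_ge0 //; case: t' => *; rewrite /om ?invr_ge0 ?exprn_ge0.
have gain w : (d <= #|[set b in Bc | g (f (par2 b)) w && g (f b) w]|)%N.
  have := pot (inl w); rewrite mul1r => potw; set c := #|_|.
  rewrite -(ler_nat R).
  have Bc_spec : Bc \subset spec by apply/subsetP => b /(subsetP BcB)/bottom_spec[].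
  have Bc2_spec : [set par2 b | b in Bc] \subset spec.
    by apply/subsetP => v /imsetP[b /(subsetP BcB)/bottom_spec[_ ?] ->].
  have prodE : \prod_(v in spec) phi v (f (pred v)) (f v) (inl w) =
     (\prod_(v in [set par2 b | b in Bc]) (expR (128%:R^-1 / 2%:R * kappa) * expR (- ((g (f v) w)%:R * kappa)))) *
     (\prod_(b in Bc) (expR (128%:R^-1 / 2%:R * (g (f (par2 b)) w)%:R)
       * expR (- ((g (f b) w)%:R * (g (f (par2 b)) w)%:R)))).
    rewrite (bigID (fun v => v \in [set par2 b | b in Bc])) /=; congr (_ * _).
      apply: eq_big => [v|v /andP[_ ->] //].
      by apply/andP/idP => [[]//|vB]; rewrite (subsetP Bc2_spec).
    rewrite (bigID (fun v => v \in Bc)) /= [X in _ * X]big1 ?mulr1; last first.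
      by move=> v /andP[/andP[_ /negbTE ->] /negbTE ->].
    apply: eq_big => [v|v /andP[/andP[vs /negbTE ->] ->]]; last by rewrite pred_spec.
    apply/idP/idP => [/andP[]//|vB]; rewrite vB (subsetP Bc_spec) // andbT /=.
    apply/imsetP => -[b /(subsetP BcB) bB E]; have [_ r1 _] := B_bottom (subsetP BcB _ vB).
    have [_ r2 _] := B_bottom bB; have [d0 d1 _ _] := depBs bB.
    by move: r1 r2; rewrite E d0 d1; clear; lia.
  rewrite prodE big_imset /= in potw; last first.
    by move=> b b' bB b'B; apply: par2_inj_B; apply: (subsetP BcB).
  rewrite -big_split /= in potw.
  (* Because [kappa] equals [1 / 128 / 2], the credit given to [par2 b] cancels against the charge
     of [b]; what remains is [kappa ^ 2] against the event that [w] suits the slot. *)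
  have termE b : expR (128%:R^-1 / 2%:R * kappa) * expR (- ((g (f (par2 b)) w)%:R * kappa)) *
    (expR (128%:R^-1 / 2%:R * (g (f (par2 b)) w)%:R) * expR (- ((g (f b) w)%:R * (g (f (par2 b)) w)%:R)))
    = expR (kappa * kappa - (g (f (par2 b)) w && g (f b) w)%:R).
    have kE : 128%:R^-1 / 2%:R = kappa by rewrite /kappa -invfM -natrM.
    rewrite kE -!expRD; congr expR; case: (g (f (par2 b)) w); case: (g (f b) w) => /=; lra.
  rewrite (eq_bigr _ (fun b _ => termE b)) -expR_sum in potw.
  have {}potw : \sum_(b in Bc) (kappa * kappa - (g (f (par2 b)) w && g (f b) w)%:R) <= ln #|V|.+1%:R.
    by rewrite -ler_expR lnK ?posrE ?ltr0n.
  rewrite big_split /= sumr_const sumrN in potw.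
  have cE : \sum_(b in Bc) (g (f (par2 b)) w && g (f b) w)%:R = c%:R :> R.
    rewrite /c -sum1dep_card natr_sum [RHS]big_mkcondr /=.
    by apply: eq_bigr => b _; case: (_ && _).
  rewrite cE -[_ *+ _]mulr_natr in potw.
  have kk : kappa * kappa * #|Bc|%:R = #|Bc|%:R / (256 * 256)%:R.
    by rewrite mulrC /kappa natrM invfM.
  by move: Bc_ge; rewrite -kk; lra.
have unblocked (W : {set V}) : (d <= #|W|)%N ->
   (#|[set v in spec | nocommon W (f (pred v)) (f v)]| < d)%N.
  move=> dW.
  pose bl := [set v in spec | blocked W (f (pred v)) (f v)].
  (* The test [W] yields [K ^ #|bl| <= (n + 1) * 2 ^ n * 2 ^ #|spec|], which is at most
     [2 ^ (3 * n)]; so [k * #|bl| <= 3 * n]. *)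
  have cbl : (2 * #|bl| <= d)%N.
    have := pot (inr W) => /= potW.
    have prodE : \prod_(v in spec) ((if blocked W (f (pred v)) (f v) then K%:R else 1) / 2%:R)
       = K%:R ^+ #|bl| / 2%:R ^+ #|spec| :> R.
      rewrite big_split /= prodr_const exprVn; congr (_ * _).
      rewrite -big_mkcondr /= (eq_bigl (fun v => v \in bl)) ?prodr_const //.
      by move=> v; rewrite [RHS]in_set.
    rewrite prodE mulrC ler_pdivrMr ?exprn_gt0 // ler_pdivrMr ?exprn_gt0 // -!natrX -!natrM ler_nat in potW.
    have specV : (#|spec| <= #|V|)%N by rewrite -cUV; apply: max_card.
    have : (2 ^ (k * #|bl|) <= 2 ^ (3 * #|V|))%N.
      apply: (@leq_trans (K ^ #|bl|)%N).
        by rewrite expnM; case: #|bl| => // c; rewrite leq_exp2r.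
      apply: (leq_trans potW).
      rewrite (_ : 3 * #|V| = #|V| + #|V| + #|V|)%N; last by lia.
      rewrite !expnD; apply: leq_mul; last by rewrite leq_exp2l.
      by rewrite leq_mul2r (ltn_expl _ (isT : (1 < 2)%N)) orbT.
    rewrite leq_exp2l // => le.
    have : (k * (2 * #|bl|) <= k * d)%N by apply: leq_trans k_ge; lia.
    by rewrite leq_pmul2l.
  pose ex := [set v in spec | exc W (f (pred v))].
  (* Each of the fewer than [C2] exceptional vertices is the image of at most one tree vertex, and
     at most [Delta] slots hang below that one. *)
  have cex : (#|ex| <= Delta * C2)%N.
    rewrite -sum1_card (partition_big (fun v => f (pred v)) (fun x => x \in [set x | exc W x])) /=; last first.
      by move=> v; rewrite !inE => /andP[].
    apply: (@leq_trans (\sum_(x in [set x | exc W x]) Delta)); last first.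
      by rewrite sum_nat_const mulnC leq_mul2l (ltnW (few_exc dW)) orbT.
    apply: leq_sum => x _; rewrite sum1_card.
    rewrite (_ : #|_| = #|[set v in ex | f (pred v) == x]|); last by apply: eq_card => v; rewrite [RHS]in_set.
    have [->|/set0Pn[v]] := eqVneq [set v in ex | f (pred v) == x] set0; first by rewrite cards0.
    move=> /setIdP[/setIdP[vs _] /eqP Ev].
    rewrite -(card_in_imset (f := par)); last first.
      by move=> a b /setIdP[/setIdP[a_s _] _] /setIdP[/setIdP[b_s _] _]; apply: spec_par_inj.
    apply: leq_trans (kids_le e_sym tree Delta_max setT (par2 v)); apply: subset_leq_card.
    apply/subsetP => i /imsetP[a /setIdP[/setIdP[a_s _] /eqP Ea] ->].
    have [ar pa] := andP (etrans (esym (specE a)) a_s).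
    rewrite in_set in_setT /= Ir //=; apply/eqP; rewrite -!pred_spec //; apply: finj; last by rewrite Ea Ev.
      by apply: (predP _ _ _).1 => //; apply: spec_I.
    by apply: (predP _ _ _).1; [apply: spec_I|move: vs; rewrite specE => /andP[]].
  have sub : [set v in spec | nocommon W (f (pred v)) (f v)] \subset bl :|: ex.
    apply/subsetP => v /setIdP[vs nc]; apply/setUP.
    case E: (exc W (f (pred v))); [right|left]; apply/setIdP; split => //.
    by rewrite /blocked dW nc E.
  have := leq_trans (subset_leq_card sub) (leq_card_setU _ _).
  by move: cbl cex d_gt; lia.
have usedA : (#|A true :&: (f @: D)| <= (2 * #|Bc|).+1)%N.
  have sub : A true :&: (f @: D) \subset f @: (r |: [set u in spec | cls u]).
    apply/subsetP => y; rewrite inE => /andP[yA /imsetP[v vD E]]; rewrite E in yA *.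
    apply: imset_f; rewrite in_setU1 in_set; case: eqP => //= /eqP vr.
    have [vs|vs] := boolP (v \in spec); last first.
      by have := (ford v vD vr vs).2; rewrite in_setU yA.
    have := fspec v vs; rewrite in_set => /andP[]; case: (cls v) => // yA2 _.
    by have := disjointFr disA yA; rewrite yA2.
  apply: leq_trans (subset_leq_card sub) _; apply: leq_trans (leq_imset_card _ _) _.
  by rewrite cardsU1; apply: leq_trans (leq_add (leq_b1 _) card_ctrl) _.
pose ok i w := [exists v in spec, [&& par v == i, g (f (pred v)) w & g (f v) w]].
have [i|w wD|S W SD WD cS cW|F [Finj FD Fok]] := @complete_matching U V D f ok d cUV finj.
- rewrite DE negbK => /slot_spec[v vs pv].
  have := fspec v vs; rewrite in_set => /andP[_]; rewrite /good_pair /codegree => gd.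
  set Q := A true :&: neighbors g (f (pred v)) :&: neighbors g (f v) in gd.
  apply: (@leq_trans #|Q :\: (f @: D)|).
    have : (#|Q :&: (f @: D)| <= (2 * #|Bc|).+1)%N.
      by apply: leq_trans usedA; apply: subset_leq_card; apply: setSI; rewrite /Q -setIA; apply: subsetIl.
    have := leq_trans A1_geL gd; rewrite leq_pmul2l; last by move: L_ge; lia.
    by rewrite -(cardsID (f @: D) Q); lia.
  apply: subset_leq_card; apply/subsetP => y; rewrite in_setD 2!in_setI !(in_set, in_setC).
  move=> /and3P[-> /andP[_ g1] g2] /=.
  by apply/exists_inP; exists v; rewrite // pv eqxx g1.
- apply: leq_trans (gain w) _; rewrite -(card_in_imset (f := par)); last first.
    by move=> b b'; rewrite !inE => /andP[bB _] /andP[b'B _]; apply: par_inj_B; apply: (subsetP BcB).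
  apply: subset_leq_card; apply/subsetP => i /imsetP[b]; rewrite inE => /andP[bB /andP[g1 g2]] ->.
  have [bs _] := bottom_spec (subsetP BcB _ bB).
  rewrite in_set in_setC DE negbK; move: (bs); rewrite specE => /andP[_ ->] /=.
  by apply/exists_inP; exists b; rewrite // eqxx pred_spec // g1.
- have [/exists_inP[i iS /exists_inP[w wW oki]]|none] := boolP [exists i in S, exists w in W, ok i w].
    by exists i, w.
  have := unblocked W cW; rewrite ltnNge => /negP; case; apply: leq_trans cS _.
  apply: leq_trans (leq_imset_card par _); apply: subset_leq_card; apply/subsetP => i iS.
  have iI : i \in I by have := subsetP SD _ iS; rewrite in_setC DE negbK.
  have [v vs pv] := slot_spec iI; rewrite -pv; apply: imset_f; rewrite in_set vs /=.
  rewrite /nocommon -setI_eq0; apply/set0Pn => -[w]; rewrite !inE => /andP[/andP[wW g1] g2].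
  case/negP: none; apply/exists_inP; exists i => //; apply/exists_inP; exists w => //.
  by apply/exists_inP; exists v; rewrite // pv eqxx g1.
exists F => // x y exy.
have gpar v : v != r -> g (F (par v)) (F v).
  move=> vr; have [vD|vD] := boolP (v \in D); last first.
    have vI : v \in I by rewrite DE negbK in vD.
    have pD : par v \in D.
      rewrite DE; apply/negP => pI; have := depI pI; have := depI vI.
      by rewrite (parP _ vr).2 /= => + h; rewrite h; case: (odd res).
    have /exists_inP[v' vs' /and3P[/eqP pv' g1 _]] := Fok v vD.
    by rewrite (FD _ pD); move: g1; rewrite pred_spec // pv'.
  rewrite (FD _ vD); have [pD|pD] := boolP (par v \in D).
    have vs : v \notin spec by rewrite specE vr -DE.
    rewrite (FD _ pD); have := (ford v vD vr vs).1.
    by rewrite /pred ifN // -DE.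
  have vs : v \in spec by rewrite specE vr; rewrite DE negbK in pD.
  have /exists_inP[v' vs' /and3P[/eqP pv' _ g2]] := Fok _ pD.
  by move: g2; rewrite (spec_par_inj vs' vs pv') gsym.
by case: (edgeP _ _ exy) => -[vr ->]; rewrite ?gpar // gsym gpar.
Qed.
End PathCase.

Lemma dense_mono (V : finType) (g : rel V) C y y' : y <= y' -> dense g C y -> dense g C y'.
Proof. by move=> yy' H X Y CX yY; apply: H => //; apply: leq_trans yY. Qed.

Lemma exists_inner_vertex (U : finType) (e : rel U) : is_tree e -> 2 < #|U| ->
  exists r, r \notin leaves e.
Proof.
move=> etree U3; have [[e_sym irr] conn _] := etree.
apply/existsP; apply: contraLR U3 => /existsPn all_leaf; rewrite -leqNgt.
have [-> //|/card_gt0P[r _]] := posnP #|U|.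
have [par [dep [par_r dr parP edgeP]]] := rooted_tree r etree.
have leaf v w w' : e v w -> e v w' -> w = w'.
  have := all_leaf v; rewrite negbK inE => /card_le1_eqP H vw vw'.
  by apply/esym; apply: H; rewrite inE.
have parE v : v != r -> par v = r.
  move=> vr; apply/eqP; apply: contraT => pr; have [ev dv] := parP _ vr; have [ep dp] := parP _ pr.
  have := leaf _ _ _ ep (etrans (e_sym _ _) ev) => E; rewrite E in dp; lia.
have sub : [set: U] \subset r |: neighbors e r.
  apply/subsetP => v _; rewrite !inE; case: eqP => //= /eqP vr.
  by have := (parP _ vr).1; rewrite (parE v vr) e_sym.
rewrite -cardsT; apply: leq_trans (subset_leq_card sub) _.
rewrite cardsU1; apply: (@leq_add _ _ 1 1); first by case: (_ \in _).
by have := all_leaf r; rewrite negbK inE.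
Qed.

(** * Trees with many leaves: concentrated and spread leaves *)

Section LeafSpanning.
Local Open Scope ring_scope.
Variables (R : realType) (U V : finType) (g : rel V) (e : rel U).
Variables (A : {set V}) (Delta C y1 z theta L C2 d w0 : nat) (x0 : V).
Hypothesis cUV : #|U| = #|V|.
Hypothesis gsym : symmetric g.
Hypothesis etree : is_tree e.
Hypothesis Delta_max : forall u, (#|neighbors e u| <= Delta)%N.
Hypothesis U3 : (2 < #|U|)%N.
Hypothesis g_dense : dense g C y1.
Hypothesis g_dense2 : dense g C2 d.
Hypothesis degA : forall x, (#|A| <= 64 * #|A :&: neighbors g x|)%N.
Hypothesis degF : forall x, (theta < #|neighbors g x :\: A|)%N.
Hypothesis x0_good : forall w, good_pair g A L x0 w.
Hypothesis C_gt0 : (0 < C)%N.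
Hypothesis d_gt0 : (0 < d)%N.
Hypothesis Delta_gt0 : (0 < Delta)%N.
Hypothesis L_ge : (64 * 64 <= L)%N.
Hypothesis y1_le : (64 * y1 <= #|A|)%N.
Hypothesis y1_z : (y1 <= z)%N.
Hypothesis theta_le : (64 * theta <= z)%N.
Hypothesis theta_ge : (C.+1 * Delta.+1 <= theta)%N.
Hypothesis room : (#|A| + C * Delta + z <= #|leaves e|)%N.
Hypothesis mass : (C.+1 * w0 + Delta <= #|leaves e|)%N.
Hypothesis A_ge : (64 * (d + (C.+1 * w0 + Delta).+1) <= #|A|)%N.
Hypothesis A_geL : (2 * L * (C.+1 * w0 + Delta) <= #|A|)%N.
Hypothesis d_ge : (Delta * C2 <= d)%N.
Hypothesis w0_ge : d%:R + Delta%:R * ln (#|V|%:R : R) <= w0%:R / (4 * L)%:R.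

Local Notation lv := (leaves e).
(** This counts leaves without reference to a root, as the root depends on the case distinction
    below. *)
Let wt p := #|[set l in lv | e p l]|.

Let e_sym : symmetric e.
Proof. by case: etree => -[]. Qed.

Lemma leaf_weightE r par dep p : rooted_at e r par dep -> r \notin lv ->
  leaf_weight e par p = wt p.
Proof.
move=> tree r_leaf; have [_ _ parP edgeP] := tree.
apply: eq_card => l; rewrite !in_set; apply: andb_id2l => ll.
have ll' : l \in lv by rewrite in_set.
have lr : l != r by apply: contraTneq ll' => ->.
apply/eqP/idP => [<-|epl]; first by rewrite e_sym; exact: (parP _ lr).1.
case: (edgeP _ _ epl) => -[pr E //].
by have := par_notin_leaves e_sym tree r_leaf pr; rewrite -E ll'.
Qed.

(** If the inner neighbours of some [q] carry [w0] leaves, the tree is rooted at [q] and [q] goes to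
    [x0], which is good for every [w]. Otherwise the leaves are so spread that the few bad partners
    of [w] cannot spoil many of them. *)
Theorem leaf_spanning : contains_copy g e.
Proof.
have [[_ irr] _ _] := etree.
have gz := dense_mono y1_z g_dense.
have L_gt0 : (0 < L)%N by apply: leq_trans L_ge.
have [/existsP[q /andP[q_leaf heavy]]|/existsPn light] :=
    boolP [exists q, (q \notin lv) && (w0 <= \sum_(p | e q p && (p \notin lv)) wt p)%N].
  have [par [dep tree]] := rooted_tree q etree; have [_ _ parP edgeP] := tree.
  pose P1 := [set p | e q p && (p \notin lv)].
  have cP1 : (#|P1| <= Delta)%N.
    apply: leq_trans (Delta_max q); apply: subset_leq_card; apply/subsetP => p.
    by rewrite !inE => /andP[].
  apply: (@leaf_case R U V g e q par dep cUV gsym e_sym tree Delta Delta_max q_leaf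
    P1 x0 A C z theta L C2 d w0) => //.
  - apply/subsetP => p; rewrite in_set in_setD1 in_setC => /andP[eqp ->]; rewrite andbT.
    by apply: contraTneq eqp => ->; rewrite irr.
  - by move: A_ge; lia.
  - by apply: leq_trans A_geL; apply: leq_mul => //; move: cP1; clear; lia.
  move=> f w _ fq; apply: leq_trans heavy _.
  rewrite [leqLHS](eq_bigl (fun p => p \in P1)); last by move=> p; rewrite [RHS]in_set.
  rewrite [leqLHS]big_mkcond [leqRHS]big_mkcond /=; apply: leq_sum => p _.
  case: ifP => // pP; have eqp : e q p by move: pP; rewrite in_set => /andP[].
  have -> : par p = q by case: (edgeP _ _ eqp) => -[]; rewrite ?eqxx.
  by rewrite fq x0_good (leaf_weightE _ tree).
have [r r_leaf] := exists_inner_vertex etree U3.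
have [par [dep tree]] := rooted_tree r etree; have [_ _ parP edgeP] := tree.
have leafr l : l \in lv -> l != r by apply: contraTneq => ->.
pose N := [set p in ~: lv :\ r | (0 < leaf_weight e par p)%N].
have massN : (C.+1 * w0 <= \sum_(p in N) leaf_weight e par p)%N.
  have tot : (\sum_(p in ~: lv) leaf_weight e par p = #|lv|)%N.
    rewrite -[RHS]sum1_card [RHS](partition_big par (fun p => p \in ~: lv)) /=; last first.
      move=> l ll; rewrite in_setC; exact: (par_notin_leaves e_sym tree r_leaf (leafr l ll)).
    by apply: eq_bigr => p _; rewrite /leaf_weight -sum1dep_card.
  rewrite (bigD1 r) /= ?in_setC // in tot.
  have := leaf_weight_le e_sym tree Delta_max r_leaf r.
  suff : (\sum_(i in ~: lv | i != r) leaf_weight e par i <= \sum_(p in N) leaf_weight e par p)%N.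
    by move: mass; lia.
  rewrite [leqLHS]big_mkcond [leqRHS]big_mkcond /=; apply: leq_sum => p _.
  rewrite /N in_set in_setD1 [_ && (p != r)]andbC; case: (_ && _) => //=.
  by case: posnP => [->|].
(* Every vertex of [N] has a leaf below it, so [C.+1 * w0] of them carry enough mass; the bound on
   their number lets them fit into [A]. *)
have [P1 P1N [cP1 massP1]] : exists2 P1 : {set U}, P1 \subset N &
    (#|P1| <= C.+1 * w0)%N /\ (C.+1 * w0 <= \sum_(p in P1) leaf_weight e par p)%N.
  have [small|/ltnW big] := leqP #|N| (C.+1 * w0); first by exists N.
  have [P1 P1N cP1] := subset_of_card big; exists P1 => //; rewrite {1}cP1; split => //.
  rewrite -{1}cP1 -sum1_card; apply: leq_sum => p /(subsetP P1N).
  by rewrite in_set => /andP[].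
have P1sub : P1 \subset ~: lv :\ r by apply: subset_trans P1N _; apply/subsetP => p; rewrite in_set => /andP[].
apply: (@leaf_case R U V g e r par dep cUV gsym e_sym tree Delta Delta_max r_leaf
  P1 x0 A C z theta L C2 d w0) => //.
- by move: A_ge; lia.
- by apply: leq_trans A_geL; apply: leq_mul => //; move: cP1; clear; lia.
move=> f w finj _.
rewrite -(leq_add2r (\sum_(p in P1 | ~~ good_pair g A L (f (par p)) w) leaf_weight e par p)%N) -bigID /=.
apply: leq_trans massP1; rewrite mulSn leq_add2l.
pose bad := [set x | ~~ good_pair g A L x w].
rewrite (partition_big (fun p => f (par p)) (fun x => x \in bad)) /=; last first.
  by move=> p /andP[_ ?]; rewrite in_set.
(* Fewer than [C] places are bad for [w], and the tree vertex on each of them accounts for less than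
   [w0] leaves; so at most [C * w0] is lost out of [C.+1 * w0]. *)
apply: (@leq_trans (\sum_(x in bad) w0)%N); last first.
  by rewrite sum_nat_const leq_mul2r (ltnW (few_bad_pairs g_dense degA y1_le L_ge w)) orbT.
apply: leq_sum => x _.
have pD p : p \in P1 -> p != r /\ par p \in ~: lv.
  move=> /(subsetP P1sub); rewrite in_setD1 => /andP[pr _]; split => //.
  by rewrite in_setC; exact: (par_notin_leaves e_sym tree r_leaf pr).
have [/existsP[q /andP[qlv /eqP fq]]|/existsPn none] := boolP [exists q, (q \notin lv) && (f q == x)]; last first.
  rewrite big_pred0 // => p; apply/negbTE/negP => /andP[/andP[/pD[_ pp] _] /eqP E].
  by have := none (par p); rewrite -in_setC pp E eqxx.
apply: ltnW; have := light q; rewrite qlv /= -ltnNge; apply: leq_ltn_trans.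
rewrite [leqLHS]big_mkcond [leqRHS]big_mkcond /=; apply: leq_sum => p _.
case: ifP => // /andP[/andP[pP _] /eqP E]; have [pr pp] := pD p pP.
have pq : par p = q by apply: finj; rewrite ?in_setC // -?in_setC // E fq.
have -> : p \notin lv by move: (subsetP P1sub _ pP); rewrite in_setD1 in_setC => /andP[].
by rewrite e_sym -pq (parP _ pr).1 /= (leaf_weightE _ tree).
Qed.
End LeafSpanning.

(** * Bare paths in trees with few leaves *)

Section Bottoms.
Variables (U : finType) (e : rel U) (r : U) (par : U -> U) (dep : U -> nat).
Hypothesis tree : rooted_at e r par dep.

Let kids v := [set w | (w != r) && (par w == v)].
Let one := only_child_parents r par.
Let fine v := (v != r) && (par v \in one).

(** Double counting: a vertex that is no leaf has two children or an only child, and an only child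
    is [fine] and thus counted twice. There are [#|U| - 1] children in total. *)
Lemma card_not_fine : #|[set v | ~~ fine v]| <= 2 * #|leaves e|.
Proof.
have [par_r dr parP edgeP] := tree.
have c1 : #|[set v | fine v]| = \sum_(v in one) #|kids v|.
  rewrite -sum1_card (partition_big par (fun v => v \in one)) /=; last first.
    by move=> v; rewrite in_set => /andP[].
  apply: eq_bigr => v vone; rewrite sum1dep_card; apply: eq_card => w.
  by rewrite !in_set /fine; case: (par w =P v) => [->|_]; rewrite ?andbF // vone !andbT.
have ctot : \sum_v #|kids v| + 1 = #|U|.
  rewrite -cardsT (cardsD1 r) in_setT addnC; congr (_ + _).
  rewrite -[RHS]sum1_card [RHS](partition_big par xpredT) //=.
  apply: eq_bigr => v _; rewrite sum1dep_card; apply: eq_card => w.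
  by rewrite [LHS]in_set [RHS]in_set in_setD1 in_setT andbT.
have leaf0 v : #|kids v| = 0 -> v \in leaves e.
  move=> /eqP; rewrite cards_eq0 => /eqP k0; rewrite inE -(cards1 (par v)).
  apply: subset_leq_card; apply/subsetP => w; rewrite !inE => /edgeP[[_ ->]//|[wr E]].
  by have : w \in kids v; [rewrite inE wr E eqxx|rewrite k0 inE].
have key : 2 * #|U| <= \sum_v #|kids v| + 2 * #|leaves e| + #|[set v | fine v]|.
  have -> : 2 * #|U| = \sum_(v : U) 2 by rewrite sum_nat_const mulnC.
  rewrite c1 -sum1_card big_distrr /= [X in _ + X + _]big_mkcond [X in _ + X]big_mkcond /= -!big_split /=.
  apply: leq_sum => v _; case: (boolP (v \in leaves e)) => lf; first by case: ifP; lia.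
  case: ifP; rewrite inE -/(kids v) => kv; last by move/negbT: kv; rewrite -ltnNge; lia.
  suff : 0 < #|kids v| by lia.
  by rewrite lt0n; apply: contra lf => /eqP/leaf0.
have := cardsC [set v | fine v].
have -> : ~: [set v | fine v] = [set v | ~~ fine v] by apply/setP => v; rewrite !inE.
by lia.
Qed.

(** As [par] is injective on fine vertices, each of [X1], [X2], [X3] is no larger than [X0], so at
    most half of the vertices are excluded; the most frequent residue of the depth keeps a quarter
    of the rest. *)
Lemma many_bottoms : 16 * #|leaves e| <= #|U| ->
  exists res (B : {set U}), #|U| <= 8 * #|B| /\
  forall b, b \in B -> [/\ 4 <= dep b, dep b = res %[mod 4] &
    [/\ par b \in one, par (par b) \in one & par (par (par b)) \in one]].
Proof.
move=> few; have [par_r dr parP edgeP] := tree.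
pose below (X : {set U}) := [set b | fine b && (par b \in X)].
have card_below X : #|below X| <= #|X|.
  rewrite -(card_in_imset (f := par)).
    by apply: subset_leq_card; apply/subsetP => v /imsetP[b]; rewrite inE => /andP[_ ?] ->.
  move=> b b'; rewrite !in_set => /andP[/andP[br pb] _] /andP[/andP[b'r _] _] E.
  by apply: (only_child pb).
pose X0 := [set v | ~~ fine v]; pose X1 := below X0; pose X2 := below X1; pose X3 := below X2.
pose G := ~: (X0 :|: X1 :|: X2 :|: X3).
have cG : #|U| <= 2 * #|G|.
  have c0 := card_not_fine; have c1 := card_below X0; have c2 := card_below X1; have c3 := card_below X2.
  have := cardsC (X0 :|: X1 :|: X2 :|: X3); rewrite -/G.
  have := leq_of_leqif (leq_card_setU (X0 :|: X1 :|: X2) X3).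
  have := leq_of_leqif (leq_card_setU (X0 :|: X1) X2).
  have := leq_of_leqif (leq_card_setU X0 X1).
  by move: few c0 c1 c2 c3; rewrite -/X1 -/X2 -/X3 -/X0; lia.
have belowN (X : {set U}) b : fine b -> b \notin below X -> par b \notin X by move=> fb; rewrite in_set fb.
have Gfine b : b \in G -> [/\ fine b, fine (par b), fine (par (par b)) & fine (par (par (par b)))].
  rewrite in_setC !in_setU !negb_or -!andbA => /and4P[n0 n1 n2 n3].
  have f0 : fine b by rewrite in_set negbK in n0.
  have m0 := belowN _ _ f0 n1; have m1 := belowN _ _ f0 n2; have m2 := belowN _ _ f0 n3.
  have f1 : fine (par b) by rewrite in_set negbK in m0.
  have l0 := belowN _ _ f1 m1; have l1 := belowN _ _ f1 m2.
  have f2 : fine (par (par b)) by rewrite in_set negbK in l0.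
  have k0 := belowN _ _ f2 l1.
  by split => //; rewrite in_set negbK in k0.
have [res cres] : exists res : 'I_4, #|G| <= 4 * #|[set b in G | dep b %% 4 == res]|.
  apply/existsP; apply: contraT => /existsPn none.
  have : #|G| = \sum_(res < 4) #|[set b in G | dep b %% 4 == res]|.
    rewrite -sum1_card (partition_big (fun b => inord (dep b %% 4) : 'I_4) xpredT) //=.
    apply: eq_bigr => i _; rewrite -sum1dep_card; apply: eq_bigl => b; congr (_ && _).
    by rewrite -val_eqE /= inordK // ltn_mod.
  have : \sum_(res < 4) (4 * #|[set b in G | dep b %% 4 == res]|).+1 <= \sum_(res < 4) #|G|.
    by apply: leq_sum => i _; have := none i; rewrite -ltnNge.
  rewrite sum_nat_const card_ord; under eq_bigr => i _ do rewrite -addn1.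
  by rewrite big_split /= sum_nat_const card_ord -big_distrr /=; lia.
exists res, [set b in G | dep b %% 4 == res]; split; first by lia.
move=> b; rewrite in_set => /andP[/Gfine[/andP[r0 p0] /andP[r1 p1] /andP[r2 p2] /andP[r3 _]] /eqP E].
split=> //; last by rewrite E modn_small.
by rewrite (parP _ r0).2 (parP _ r1).2 (parP _ r2).2 (parP _ r3).2.
Qed.
End Bottoms.

(** * Assembling the constants *)

Definition cherry_rich (V : finType) (g : rel V) (h : nat) : Prop :=
  forall x w : {ffun bool * 'I_h -> V}, injective x -> injective w ->
     (forall a b, x a != w b) ->
     h * h %/ 32 < #|[set p : 'I_h * 'I_h |
        g (x (true, p.1)) (x (false, p.2)) &&
        (g (w (false, p.2)) (x (true, p.1)) || g (w (true, p.1)) (x (false, p.2)))]|.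

(** * All pseudorandom properties in one game *)

Section MakerGraph.
Local Open Scope ring_scope.
Variables (R : realFieldType) (V : finType).

Lemma exp2_exp8_le (m s q : nat) : (m <= 2 ^ s)%N -> (s + 3 <= 3 * q)%N ->
  m%:R * 8%:R ^- q <= 8%:R^-1 :> R.
Proof.
move=> ms sq; rewrite ler_pdivrMr ?exprn_gt0 // ler_pdivlMl // -natrX -natrM ler_nat.
apply: (@leq_trans (8 * 2 ^ s)%N); first by rewrite leq_mul2l ms orbT.
rewrite -[8%N]/(2 ^ 3)%N -expnD -expnM leq_exp2l //; lia.
Qed.

(** Each of the five certificate families has weight at most 1/8. The number [s] bounds the binary
    logarithm of [#|V|]. *)
Lemma maker_graph (A F : {set V}) (C y1 C2 y2 h s : nat) :
  (64 * #|V|.+1 <= C * y1)%N -> (2 * C <= y1)%N ->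
  (64 * #|V|.+1 <= C2 * y2)%N -> (2 * C2 <= y2)%N ->
  (3 <= #|V|)%N -> (#|V| <= 2 ^ s)%N ->
  (s + 3 <= 3 * (#|A|.-1 %/ 32))%N -> (s + 3 <= 3 * (#|F|.-1 %/ 32))%N ->
  (4 * h * s + 3 <= 3 * (h * h %/ 32))%N ->
  maker_can_achieve (complete_edges V) (fun M =>
    [/\ dense (edge_rel M) C y1, dense (edge_rel M) C2 y2,
        forall x, (#|A| <= 64 * #|A :&: neighbors (edge_rel M) x|)%N,
        forall x, (#|F| <= 64 * #|F :&: neighbors (edge_rel M) x|)%N &
        cherry_rich (edge_rel M) h]).
Proof.
move=> c1 c1' c2 c2' V3 Vs sA sF sh.
have e1 := es_bound_dense R c1 c1'; have e2 := es_bound_dense R c2 c2'.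
have e3 := es_bound_degree R A; have e4 := es_bound_degree R F.
have e5 := es_bound_cherry R V h.
have := es_bound_and e1 (es_bound_and e2 (es_bound_and e3 (es_bound_and e4 e5))).
move/es_bound_mono => /(_ _ _ (fun _ => id) (lexx _))/(es_bound_maker set0) H.
apply: maker_can_achieve_mono (H _).
  by move=> M [d1 [d2 [g1 [g2 ch]]]]; split.
have b1 : 2%:R ^- #|V| <= 8%:R^-1 :> R.
  rewrite lef_pV2 ?posrE ?exprn_gt0 // -natrX ler_nat -[8%N]/(2 ^ 3)%N leq_exp2l //.
have b3 := exp2_exp8_le Vs sA; have b4 := exp2_exp8_le Vs sF.
have b5 : (#|V| ^ (4 * h))%:R * 8%:R ^- (h * h %/ 32) <= 8%:R^-1 :> R.
  apply: exp2_exp8_le sh; rewrite [X in (_ <= 2 ^ X)%N]mulnC [X in (_ <= X)%N]expnM.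
  by case: (4 * h)%N => [|m]; rewrite ?expn0 // leq_exp2r.
by lra.
Qed.
End MakerGraph.

Section PathSpanning.
Local Open Scope ring_scope.
Variables (R : realType) (U V : finType) (g : rel V) (e : rel U).
Hypothesis cUV : #|U| = #|V|.
Hypothesis gsym : symmetric g.
Hypothesis etree : is_tree e.
Variables (Delta : nat).
Hypothesis Delta_max : forall u, (#|neighbors e u| <= Delta)%N.
Variables (A : bool -> {set V}) (x0 : V) (C y1 z theta L C2 y2 d K k m m1 : nat).
Hypothesis few_leaves : (16 * #|leaves e| <= #|U|)%N.
Hypothesis m_le : (8 * m <= #|U|)%N.
Hypothesis m1_le : (m1 <= m)%N.
Hypothesis C_gt0 : (0 < C)%N.
Hypothesis g_dense : dense g C z.
Hypothesis g_dense1 : dense g C y1.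
Hypothesis g_dense2 : dense g C2 y2.
Hypothesis disA : [disjoint A true & A false].
Hypothesis degA : forall x, (#|A true| <= 64 * #|A true :&: neighbors g x|)%N.
Hypothesis degF : forall x, (theta < #|neighbors g x :\: (A true :|: A false)|)%N.
Hypothesis y1_le : (64 * y1 <= #|A true|)%N.
Hypothesis y2_gt0 : (0 < y2)%N.
Hypothesis y2_le : (64 * y2 <= d)%N.
Hypothesis L_ge : (64 * 64 <= L)%N.
Hypothesis theta_le : (64 * theta <= z)%N.
Hypothesis theta_ge : (C.+1 * Delta.+1 <= theta)%N.
Hypothesis room : (#|A true :|: A false| + C * Delta + z <= 4 * m)%N.
Hypothesis A2_ge : (#|A true| + 2 * m <= #|A false|)%N.
Hypothesis A1_ge : (128 * (C + 2 * m1) <= #|A true|)%N.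
Hypothesis A1_geL : (L * (d + (2 * m1).+1) <= #|A true|)%N.
Hypothesis A1_geK : (K * C2 + C + 2 * m1 < #|A true|)%N.
Hypothesis K_ge : (2 ^ k <= K)%N.
Hypothesis k_gt0 : (0 < k)%N.
Hypothesis k_ge : (6 * #|V| <= k * d)%N.
Hypothesis d_gt : (2 * (Delta * C2) < d)%N.
Hypothesis Bc_ge : d%:R + ln (#|V|.+1%:R : R) <= m1%:R / (256 * 256)%:R.

Theorem path_spanning : contains_copy g e.
Proof.
have [[e_sym _] _ _] := etree.
have [U0|/card_gt0P[r _]] := posnP #|U|.
  by move: A1_geK; rewrite -(cardsID (A false) (A true)); have := max_card (mem (A true)); rewrite -cUV U0; lia.
have [par [dep tree]] := rooted_tree r etree.
have [res [B0 [cB0 B0P]]] := many_bottoms tree few_leaves.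
have [B BB0 cB] : exists2 B : {set U}, B \subset B0 & #|B| = m by apply: subset_of_card; move: m_le cB0; lia.
have [Bc BcB cBc] : exists2 Bc : {set U}, Bc \subset B & #|Bc| = m1 by apply: subset_of_card; rewrite cB.
subst m m1.
apply: (@path_case R U V g e r par dep cUV gsym e_sym tree Delta Delta_max
  B Bc res x0 A C y1 z theta L C2 y2 d K k) => //.
by move=> b /(subsetP BB0)/B0P.
Qed.
End PathSpanning.

Lemma square_le_exp2 q : 4 <= q -> q * q <= 2 ^ q.
Proof.
elim: q => // q IH; rewrite ltnS leq_eqVlt => /orP[/eqP <- //|lt].
by rewrite expnS; have := IH lt; nia.
Qed.

Lemma eventually_lt_exp2 Q : 0 < Q -> exists N, forall n, N <= n -> n < 2 ^ (n %/ Q).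
Proof.
move=> Q0; exists (Q * (2 * Q + 4)) => n nN.
have q_ge : 2 * Q + 4 <= n %/ Q by rewrite leq_divRL // mulnC.
have := ltn_ceil n Q0; move: (n %/ Q) q_ge => q q_ge lt.
apply: (@leq_trans (q * q)); last by apply: square_le_exp2; lia.
by apply: leq_trans lt _; nia.
Qed.

(** * Both kinds of trees in the same graph *)

Section TreeUniversality.
Local Open Scope ring_scope.
Variables (R : realType) (V : finType) (g : rel V) (A1 A2 : {set V}).
Variables (C C2 L M k a t h Delta : nat).
Hypothesis gsym : symmetric g.
Hypothesis g_dense : dense g C (a %/ 64).
Hypothesis g_dense2 : dense g C2 (t %/ 64).
Hypothesis degA : forall x, (#|A1| <= 64 * #|A1 :&: neighbors g x|)%N.
Hypothesis degF : forall x, (#|~: (A1 :|: A2)| <= 64 * #|~: (A1 :|: A2) :&: neighbors g x|)%N.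
Hypothesis cherries : cherry_rich g h.
Hypothesis cA1 : #|A1| = a.
Hypothesis cA2 : #|A2| = (7 * a)%N.
Hypothesis disA : [disjoint A1 & A2].
Hypothesis C_ge : (64 <= C)%N.
Hypothesis L_def : L = (128 * (8 * C + 8))%N.
Hypothesis M_ge : (64 * (C.+1 * (8 * L) + 4) + 2 * L * (C.+1 * (8 * L) + 1) +
  128 * (1 + 4 * (256 * 256)) + L * (2 + 4 * (256 * 256)) + 4 * (256 * 256) + 4 <= M)%N.
Hypothesis Mt : (M * t <= a)%N.
Hypothesis n_lo : (200 * a <= #|V|)%N.
Hypothesis n_hi : (6 * #|V| <= k * t)%N.
Hypothesis k_gt0 : (0 < k)%N.
Hypothesis h_le : (h * (4 * C + 4) <= a)%N.
Hypothesis h_ge : (a < h.+1 * (4 * C + 4))%N.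
Hypothesis h8 : (8 <= h)%N.
Hypothesis t_ge : (2 ^ k * C2 + C < t)%N.
Hypothesis t64 : (64 <= t)%N.
Hypothesis Delta_gt0 : (0 < Delta)%N.
Hypothesis Delta_t : ((C + 2 * C2 + 1) * Delta.+1 < t)%N.
Hypothesis Delta_ln : Delta%:R * ln (#|V|%:R : R) <= t%:R.
Hypothesis ln_t : ln (#|V|.+1%:R : R) <= t%:R.

Let Ma c : (c <= M)%N -> (c * t <= a)%N.
Proof. by move=> cM; apply: leq_trans Mt; rewrite leq_mul2r cM orbT. Qed.

Let L_ge : (64 * 64 <= L)%N.
Proof. by rewrite L_def; lia. Qed.

Let CD : (C * Delta <= t)%N /\ (C2 * Delta <= t)%N.
Proof. by move: Delta_t; rewrite !mulnDl !mulnS; clear; nia. Qed.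

Theorem tree_universality (U : finType) (e : rel U) : #|U| = #|V| -> is_tree e ->
  (forall u, (#|neighbors e u| <= Delta)%N) -> contains_copy g e.
Proof.
move=> cUV etree Delta_max.
have ta : (4 * (256 * 256) * t <= a)%N by apply: Ma; move: M_ge; clear; lia.
have t_a : (1000 * t <= a)%N by move: ta; clear; lia.
have a64 : (64 <= a)%N by move: t_a t64; clear; lia.
have Dt : (Delta.+1 <= t)%N by apply: leq_trans (ltnW Delta_t); rewrite leq_pmull // addn1.
have [CDt C2Dt] := CD.
have [x0 x0_good] : exists x, forall w, good_pair g A1 L x w.
  apply: (exists_good_vertex g_dense degA _ L_ge cherries gsym); rewrite ?cA1.
  - by rewrite mulnC leq_divM.
  - by apply: leq_trans h_le; rewrite (mulnC 2) -mulnA leq_mul2l; apply/orP; right; clear; lia.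
  (* Rounding costs a factor 2 twice, here and in [a < h * (8 * C + 8)]; this gives [L]. *)
  - have h2 : (h * h <= 64 * (h * h %/ 32))%N.
      by move: (leq_mul h8 h8); move: (h * h)%N; clear => q; lia.
    rewrite L_def; have : (2 * h * a <= 2 * h * (h * (8 * C + 8)))%N.
      by rewrite leq_mul2l; apply/orP; right; move: h_ge h8; clear; nia.
    have : ((8 * C + 8) * (h * h) <= (8 * C + 8) * (64 * (h * h %/ 32)))%N by rewrite leq_mul2l h2 orbT.
    by clear; nia.
  by move: a64; clear; lia.
have theta_ge : (C.+1 * Delta.+1 <= a %/ 64)%N.
  rewrite leq_divRL //; move: Delta_t t_a; clear.
  have : (C.+1 * Delta.+1 <= (C + 2 * C2 + 1) * Delta.+1)%N by rewrite leq_mul2r; apply/orP; right; lia.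
  by lia.
have y1_le : (64 * (a %/ 64) <= a)%N by rewrite mulnC leq_divM.
have y1_a : (a %/ 64 <= a)%N by apply: leq_div.
have freeA x : (a %/ 64 < #|neighbors g x :\: (A1 :|: A2)|)%N.
  have := degF x; rewrite setIC -setDE.
  have : (#|V| <= #|~: (A1 :|: A2)| + 8 * a)%N.
    rewrite -(cardsC (A1 :|: A2)) addnC leq_add2l; apply: leq_trans (leq_card_setU _ _) _.
    by rewrite cA1 cA2; clear; lia.
  by move: n_lo a64; clear; lia.
have gz := dense_mono y1_a g_dense.
have [few|/ltnW many] := leqP (16 * #|leaves e|) #|U|.
  (* The [3 * a] paths free [12 * a] vertices, enough for the [8 * a] reserved ones, [z = a] and
     [C * Delta]. With [2 * 256 ^ 2 * t] control paths the gain is [2 * t], half of which pays for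
     the logarithm. *)
  apply: (@path_spanning R U V g e cUV gsym etree Delta Delta_max (fun b => if b then A1 else A2) x0
    C (a %/ 64) a (a %/ 64) L C2 (t %/ 64) t (2 ^ k) k (3 * a) (2 * (256 * 256) * t)) => //; rewrite ?cA1 ?cA2 //.
  - by rewrite cUV; move: n_lo; clear; lia.
  - by move: ta; clear; lia.
  - by move: C_ge; clear; lia.
  - by rewrite divn_gt0.
  - by rewrite mulnC leq_divM.
  - have := leq_of_leqif (leq_card_setU A1 A2); rewrite cA1 cA2.
    by rewrite /= => ?; move: CDt t_a; lia.
  - by clear; lia.
  - have : (128 * (1 + 4 * (256 * 256)) * t <= a)%N by apply: Ma; move: M_ge; clear; lia.
    by move: t_ge; clear; lia.
  - have := @Ma (L * (2 + 4 * (256 * 256)))%N; have -> : (L * (2 + 4 * (256 * 256)) <= M)%N.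
      by move: M_ge; clear; lia.
    move=> /(_ isT); apply: leq_trans; rewrite -[leqRHS]mulnA leq_mul2l; apply/orP; right.
    by move: t64; clear; lia.
  - have := @Ma (4 * (256 * 256) + 4)%N; have -> : (4 * (256 * 256) + 4 <= M)%N by move: M_ge; clear; lia.
    by move=> /(_ isT); move: t_ge; clear; lia.
  - by move: Delta_t; clear; nia.
  have -> : (2 * (256 * 256) * t)%:R / (256 * 256)%:R = 2%:R * t%:R :> R.
    move: (256 * 256)%N (isT : (0 < 256 * 256)%N) => q q0.
    by rewrite mulnAC natrM mulfK ?natrM // pnatr_eq0 -lt0n.
  by move: ln_t; lra.
have lv_ge : (12 * a <= #|leaves e|)%N by move: many n_lo; rewrite cUV; clear; lia.
have dense2 : dense g C2 t by apply: dense_mono g_dense2; apply: leq_div.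
have MaE : ((64 * (C.+1 * (8 * L) + 4)) * t <= a)%N by apply: Ma; move: M_ge; clear; lia.
have MaL : ((2 * L * (C.+1 * (8 * L) + 1)) * t <= a)%N by apply: Ma; move: M_ge; clear; lia.
(* The choice [w0 = 8 * L * t] makes [w0 / (4 * L)] equal to [2 * t], half of which pays for
   [Delta * ln n]. *)
apply: (@leaf_spanning R U V g e A1 Delta C (a %/ 64) a (a %/ 64) L C2 t (8 * L * t) x0) => //; rewrite ?cA1 //.
- by rewrite cUV; move: n_lo a64; clear; lia.
- by move=> x; apply: leq_trans (freeA x) _; apply: subset_leq_card; apply: setDS; apply: subsetUl.
- by move: C_ge; clear; lia.
- by move: t64; clear; lia.
- by move: CDt t_a lv_ge; clear; lia.
- by move: MaE lv_ge Dt; rewrite mulnA; move: (C.+1 * (8 * L))%N => E; clear; nia.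
- by move: MaE Dt; rewrite mulnA; move: (C.+1 * (8 * L))%N => E; clear; nia.
- apply: leq_trans MaL; rewrite -(mulnA (2 * L)) leq_mul2l; apply/orP; right.
  by rewrite mulnA mulnDl mul1n leq_add2l; move: Dt; clear; lia.
- by rewrite mulnC.
have -> : (8 * L * t)%:R / (4 * L)%:R = 2%:R * t%:R :> R.
  rewrite (_ : (8 * L * t)%N = (2 * t * (4 * L))%N); last by clear; lia.
  rewrite [X in X / _]natrM mulfK ?natrM // -natrM pnatr_eq0 muln_eq0 negb_or /= -lt0n.
  exact: leq_trans L_ge.
by move: Delta_ln; lra.
Qed.
End TreeUniversality.

Lemma ltn_2mul_div Q n : 0 < Q -> Q <= n -> n < 2 * Q * (n %/ Q).
Proof.
move=> Q0 Qn; have := ltn_ceil n Q0; have : 0 < n %/ Q by rewrite divn_gt0.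
by move: (n %/ Q) => q q0 lt; apply: leq_trans lt _; rewrite mulnC (mulnC 2) -mulnA leq_mul2l; lia.
Qed.

Lemma leq_div_of_mul X Q n : 0 < Q -> X * Q <= n -> X <= n %/ Q.
Proof. by move=> Q0; rewrite leq_divRL. Qed.

Local Open Scope ring_scope.

Theorem theorem1p1 (R : realType) :
  exists2 c : R, 0 < c &
  exists N : nat, forall n : nat, (N <= n)%N ->
    maker_can_achieve (complete_edges 'I_n)
      (fun M : {set {set 'I_n}} =>
         forall (V : finType) (e : rel V),
           #|V| = n -> is_tree e ->
           (max_degree e)%:R <= c * n%:R / ln (n%:R : R) ->
           contains_copy (edge_rel M) e).
Proof.
(* Here [128] is the 64 required for density times a 2 for rounding, and [200 * 64] is the ratio of
   [n] to [a %/ 64]; [C2] arises likewise from [t %/ 64]. The equations keep the huge numerals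
   opaque. *)
have [C Cdef] : exists C, C = (128 * (200 * 64))%N by exists (128 * (200 * 64))%N.
have [L Ldef] : exists L, L = (128 * (8 * C + 8))%N by exists (128 * (8 * C + 8))%N.
have [M Mdef] : exists M, M = (64 * (C.+1 * (8 * L) + 4) + 2 * L * (C.+1 * (8 * L) + 1) +
  128 * (1 + 4 * (256 * 256)) + L * (2 + 4 * (256 * 256)) + 4 * (256 * 256) + 4)%N by eexists.
have M0 : (0 < M)%N by rewrite Mdef addn4.
have [C2 C2def] : exists C2, C2 = (128 * (200 * M * 64))%N by eexists.
have [k kdef] : exists k, k = (6 * (2 * (200 * M)))%N by eexists.
(* [X] is a threshold to be reached by [t %/ 64], [h] and [ln n]. *)
have [X Xdef] : exists X, X = (2 ^ k * C2 + C + 4 * (C + 2 * C2 + 1) + 1000)%N by eexists.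
have Qt0 : (0 < 200 * M)%N by rewrite muln_gt0.
have Qh0 : (0 < 200 * (4 * C + 4))%N by rewrite muln_gt0 addn4.
have Qs0 : (0 < 200 * (4 * C + 4) * 128)%N by rewrite muln_gt0 Qh0.
have [N1 N1P] := eventually_lt_exp2 Qs0.
have [N2 N2P] := eventually_lt_exp2 Qt0.
(* Since [n < 2 * (200 * M) * t], this constant turns the degree bound into [Delta * ln n <= t]. *)
exists ((2 * (200 * M))%:R^-1); first by rewrite invr_gt0 ltr0n muln_gt0.
exists (N1 + N2 + Num.bound (expR (X%:R : R)) + X * (200 * M * 64) + X * (200 * (4 * C + 4)))%N => n nN.
pose a := (n %/ 200)%N; pose t := (n %/ (200 * M))%N; pose h := (n %/ (200 * (4 * C + 4)))%N.
pose s := (n %/ (200 * (4 * C + 4) * 128))%N.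
have aE : (a %/ 64 = n %/ (200 * 64))%N by rewrite /a divnMA.
have tE : (t = a %/ M)%N by rewrite /t /a divnMA.
have t64E : (t %/ 64 = n %/ (200 * M * 64))%N by rewrite /t -divnMA.
have hE : (h = a %/ (4 * C + 4))%N by rewrite /h /a divnMA.
have sE : (s = h %/ 128)%N by rewrite /s /h divnMA.
have n_s : (n < 2 ^ s)%N by apply: N1P; apply: leq_trans nN; clear; lia.
have n_t : (n < 2 ^ t)%N by apply: N2P; apply: leq_trans nN; clear; lia.
have X_y2 : (X <= t %/ 64)%N.
  by rewrite t64E; apply: leq_div_of_mul; [rewrite muln_gt0 Qt0|apply: leq_trans nN; clear; lia].
have X_h : (X <= h)%N by apply: leq_div_of_mul => //; apply: leq_trans nN; clear; lia.
have h_a : (h <= a)%N by rewrite hE leq_div.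
have t_a : (M * t <= a)%N by rewrite tE mulnC leq_divM.
have tn : (n < 2 * (200 * M) * t)%N.
  apply: ltn_2mul_div => //; apply: leq_trans nN; rewrite -(mul1n (200 * M)%N); move: Xdef; clear; nia.
have Xt : (X <= t)%N by apply: leq_trans X_y2 (leq_div _ _).
have a_n : (200 * a <= n)%N by rewrite mulnC leq_divM.
have X1000 : (1000 <= X)%N by rewrite Xdef; clear; lia.
have y2_y1 : (t %/ 64 <= a %/ 64)%N.
  by rewrite leq_div2r // tE leq_div.
have [A1 _ cA1] : exists2 A1 : {set 'I_n}, A1 \subset setT & #|A1| = a.
  by apply: subset_of_card; rewrite cardsT card_ord; move: a_n; clear; lia.
have [A2 A2sub cA2] : exists2 A2 : {set 'I_n}, A2 \subset ~: A1 & #|A2| = (7 * a)%N.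
  by apply: subset_of_card; have := cardsC A1; rewrite cA1 card_ord; move: a_n; clear; lia.
have disA : [disjoint A1 & A2] by rewrite disjoint_sym disjoints_subset.
have cF : (a <= #|~: (A1 :|: A2)|)%N.
  have := cardsC (A1 :|: A2); have := leq_of_leqif (leq_card_setU A1 A2).
  by rewrite card_ord cA1 cA2; move: a_n; clear; lia.
have s_a : (s + 3 <= 3 * (a.-1 %/ 32))%N.
  by rewrite sE; move: h_a X_h X1000; clear; lia.
apply: maker_can_achieve_mono (@maker_graph R 'I_n A1 (~: (A1 :|: A2)) C (a %/ 64) C2 (t %/ 64) h s
  _ _ _ _ _ _ _ _ _);
  rewrite ?card_ord ?cA1 //.
- move=> G [d1 d2 g1 g2 ch] V e cV etree deg.
  have n3 : (2 < n)%N by move: a_n h_a X_h X1000; clear; lia.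
  have n0 : 0 < (n%:R : R) by rewrite ltr0n; apply: leq_trans n3.
  have lnX : (X%:R : R) <= ln n%:R.
    rewrite -ler_expR lnK ?posrE //.
    apply: le_trans (ltW (archi_boundP (expR_ge0 _))) _; rewrite ler_nat; apply: leq_trans nN.
    by clear; lia.
  have ln0 : 0 < ln (n%:R : R) by apply: lt_le_trans lnX; rewrite ltr0n; apply: leq_trans X1000.
  have Dln : (max_degree e)%:R * ln (n%:R : R) <= t%:R.
    move: deg; rewrite ler_pdivlMr // => /le_trans; apply.
    by rewrite mulrC ler_pdivrMr ?ltr0n ?muln_gt0 // mulrC -natrM ler_nat ltnW.
  have degD u : (#|neighbors e u| <= max_degree e)%N by apply: (leq_bigmax (F := fun u => #|[set y | e u y]|)).
  have D0 : (0 < max_degree e)%N.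
    have [|r] := exists_inner_vertex etree; first by rewrite cV.
    by rewrite inE -ltnNge => lt; apply: leq_trans (degD r); apply: ltnW.
  (* As [ln n] is at least [X], constant multiples of the degree are small compared with [t]. *)
  have DX : (max_degree e * X <= t)%N.
    by rewrite -(ler_nat R) natrM; apply: le_trans Dln; rewrite ler_wpM2l.
  apply: (@tree_universality R 'I_n (edge_rel G) A1 A2 C C2 L M k a t h (max_degree e)) => //;
    rewrite ?card_ord //.
  + exact: edge_rel_sym.
  + by rewrite cA1.
  + by rewrite Cdef; clear; lia.
  + by rewrite Mdef.
  + by rewrite kdef; move: tn; clear; lia.
  + by rewrite kdef; move: M0; clear; lia.
  + by rewrite hE leq_divM.
  + by rewrite hE ltn_ceil // addn4.
  + by move: X_h X1000; clear; lia.
  + by move: Xt; rewrite Xdef; clear; lia.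
  + by move: Xt X1000; clear; lia.
  + move: DX Xt D0; rewrite Xdef; move: (2 ^ k * C2)%N (C + 2 * C2 + 1)%N (max_degree e); clear; nia.
  have : ln (n.+1%:R : R) <= ln ((2%:R : R) ^+ t).
    by rewrite ler_ln ?posrE ?exprn_gt0 // -natrX ler_nat.
  move/le_trans; apply; rewrite lnXn // -[t in leRHS]mul1n [in leRHS]natrM -[leLHS]mulr_natr ler_wpM2r //.
  by have /le_ln1Dx : -1 < 1 :> R by lra.
- rewrite aE Cdef; have /(ltn_2mul_div (isT : (0 < 200 * 64)%N)) : (200 * 64 <= n)%N.
    by rewrite -(mul1n (200 * 64)%N) -leq_divRL // -aE; move: y2_y1 X_y2 X1000; clear; lia.
  by move: (n %/ _)%N => q; clear; lia.
- by apply: leq_trans y2_y1; apply: leq_trans X_y2; rewrite Xdef; clear; lia.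
- rewrite t64E C2def; have Q0 : (0 < 200 * M * 64)%N by rewrite muln_gt0 Qt0.
  have /(ltn_2mul_div Q0) : (200 * M * 64 <= n)%N.
    by rewrite -(mul1n (200 * M * 64)%N) -leq_divRL // -t64E; move: X_y2 X1000; clear; lia.
  by move: (n %/ (200 * 64))%N (200 * M * 64)%N => q Q; clear; nia.
- by apply: leq_trans X_y2; rewrite Xdef; clear; lia.
- by move: a_n h_a X_h X1000; clear; lia.
- exact: ltnW.
- by apply: leq_trans s_a _; move: cF; clear; lia.
have : (4 * h * s * 32 <= h * h)%N.
  have : (128 * s <= h)%N by rewrite sE mulnC leq_divM.
  by move/(leq_mul (leqnn h)); clear; nia.
have : (1000 * 1000 <= h * h)%N by apply: leq_mul; apply: leq_trans X_h.
by move: (4 * h * s)%N (h * h)%N; clear; lia.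
Qed.
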